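(* Let $j:\mathfrak z=\mathbb R^r\to\mathfrak{so}(\mathfrak v)=\mathfrak{so}(m)$ be a linear map, let $\{Z_1,\dots,Z_r\}$ be an orthonormal basis of $\mathfrak z$, and let $J:=\sum_{\alpha=1}^rj_{Z_\alpha}^2$. For the curvature invariants $\mathrm{scal}$, $\mathrm{scal}^2$, $|\mathrm{ric}|^2$, $|R|^2$ of $(G(j),g(j))$ we have: (i) $\mathrm{scal}=\tfrac14\mathrm{Tr}(J)=\tfrac14I_{\alpha\alpha}$, (ii) $\mathrm{scal}^2=\tfrac1{16}(\mathrm{Tr}(J))^2=\tfrac1{16}I_{\alpha\alpha|\beta\beta}$, (iii) $|\mathrm{ric}|^2=\tfrac14\mathrm{Tr}(J^2)+\tfrac1{16}I_{\alpha\beta|\alpha\beta}=\tfrac14I_{\alpha\alpha\beta\beta}+\tfrac1{16}I_{\alpha\beta|\alpha\beta}$, (iv) $|R|^2=\tfrac12\mathrm{Tr}(J^2)+\tfrac38I_{\alpha\beta|\alpha\beta}+\tfrac18I_{\alpha\beta\alpha\beta}=\tfrac12I_{\alpha\alpha\beta\beta}+\tfrac38I_{\alpha\beta|\alpha\beta}+\tfrac18I_{\alpha\beta\alpha\beta}$.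
   Context: $\mathfrak v=\mathbb R^m$, $\mathfrak z=\mathbb R^r$ carry the standard inner products. Given a linear map $j:\mathfrak z\to\mathfrak{so}(\mathfrak v)$, $Z\mapsto j_Z$, let $\mathfrak g(j)$ be the two-step nilpotent metric Lie algebra with underlying vector space $\mathfrak v\oplus\mathfrak z$, standard inner product, and bracket defined by: $\mathfrak z$ is central, $[\mathfrak v,\mathfrak v]\subseteq\mathfrak z$, and $\langle j_ZX,Y\rangle=\langle Z,[X,Y]\rangle$ for $X,Y\in\mathfrak v$, $Z\in\mathfrak z$. $G(j)$ is the simply connected Lie group with Lie algebra $\mathfrak g(j)$, endowed with the left invariant Riemannian metric $g(j)$ given by this inner product at the identity. By homogeneity the curvature invariants are constant functions. The polynomial invariants appearing are $I_{\alpha\alpha}=\sum_{\alpha}\mathrm{Tr}(j_{Z_\alpha}^2)$, $I_{\alpha\alpha|\beta\beta}=\sum_{\alpha,\beta}\mathrm{Tr}(j_{Z_\alpha}^2)\mathrm{Tr}(j_{Z_\beta}^2)$, $I_{\alpha\alpha\beta\beta}=\sum_{\alpha,\beta}\mathrm{Tr}(j_{Z_\alpha}^2j_{Z_\beta}^2)$, $I_{\alpha\beta|\alpha\beta}=\sum_{\alpha,\beta}(\mathrm{Tr}(j_{Z_\alpha}j_{Z_\beta}))^2$, $I_{\alpha\beta\alpha\beta}=\sum_{\alpha,\beta}\mathrm{Tr}(j_{Z_\alpha}j_{Z_\beta}j_{Z_\alpha}j_{Z_\beta})$, with all sums over $\{1,\dots,r\}$. $\mathrm{scal}$, $\mathrm{ric}$,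 $R$ are the scalar curvature, the Ricci tensor and the Riemannian curvature tensor; $|\mathrm{ric}|^2$ and $|R|^2$ are the sums of the squares of all components with respect to an orthonormal basis of the tangent space. *)

(* Defs.v *)
From HB Require Import structures.
From mathcomp Require Import all_boot all_order all_algebra.
From mathcomp Require Import boolp classical_sets functions reals.
From mathcomp Require Import topology normedtype derive.

Set Implicit Arguments.
Unset Strict Implicit.
Unset Printing Implicit Defensive.

Import Order.TTheory GRing.Theory Num.Theory.
Import numFieldNormedType.Exports.

Local Open Scope ring_scope.

Definition dot (R : realType) (n : nat) (u v : 'cV[R]_n) : R :=
  \sum_(i < n) u i 0 * v i 0.

Definition orthonormal_basis (R : realType) (n : nat)
    (b : 'cV[R]_n -> 'cV[R]_n -> R) (e : 'I_n -> 'cV[R]_n) : Prop :=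
  forall i k : 'I_n, b (e i) (e k) = (i == k)%:R.

(* Riemannian geometry in a global chart: a metric on R^n is given by its
   Gram matrix [g p] in the coordinate basis at each point [p]. *)

Definition pderiv (R : realType) (n : nat) (f : 'cV[R]_n -> R) (i : 'I_n)
    (p : 'cV[R]_n) : R :=
  'D_(delta_mx i 0) f p.

Definition inner (R : realType) (n : nat) (g : 'cV[R]_n -> 'M[R]_n)
    (p u v : 'cV[R]_n) : R :=
  (u^T *m g p *m v) 0 0.

(* Gamma^k_(ab); the Levi-Civita connection is
   nabla_(d_a) d_b = \sum_k Gamma^k_(ab) d_k. *)
Definition christoffel (R : realType) (n : nat) (g : 'cV[R]_n -> 'M[R]_n)
    (k a b : 'I_n) (p : 'cV[R]_n) : R :=
  2^-1 * \sum_(l < n) invmx (g p) k l *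
    (pderiv (fun q => g q b l) a p + pderiv (fun q => g q a l) b p
       - pderiv (fun q => g q a b) l p).

(* R(d_a, d_b) d_c = \sum_k (riem_coef g k a b c) d_k, with
   R(X, Y) = nabla_X nabla_Y - nabla_Y nabla_X - nabla_[X, Y]. *)
Definition riem_coef (R : realType) (n : nat) (g : 'cV[R]_n -> 'M[R]_n)
    (k a b c : 'I_n) (p : 'cV[R]_n) : R :=
  pderiv (christoffel g k b c) a p - pderiv (christoffel g k a c) b p
  + \sum_(s < n) (christoffel g k a s p * christoffel g s b c p
                  - christoffel g k b s p * christoffel g s a c p).

Definition curv_op (R : realType) (n : nat) (g : 'cV[R]_n -> 'M[R]_n)
    (p u v w : 'cV[R]_n) : 'cV[R]_n :=
  \col_k \sum_(a < n) \sum_(b < n) \sum_(c < n)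
    riem_coef g k a b c p * u a 0 * v b 0 * w c 0.

Definition riem (R : realType) (n : nat) (g : 'cV[R]_n -> 'M[R]_n)
    (p u v w z : 'cV[R]_n) : R :=
  inner g p (curv_op g p u v w) z.

(* ric(v, w) is the trace of u |-> R(u, v)w. *)
Definition ric (R : realType) (n : nat) (g : 'cV[R]_n -> 'M[R]_n)
    (p v w : 'cV[R]_n) : R :=
  \sum_(a < n) curv_op g p (delta_mx a 0) v w a 0.

Definition scal (R : realType) (n : nat) (g : 'cV[R]_n -> 'M[R]_n)
    (p : 'cV[R]_n) : R :=
  \sum_(a < n) \sum_(b < n)
    invmx (g p) a b * ric g p (delta_mx a 0) (delta_mx b 0).

(* The two norms below are meant for a [g p]-orthonormal basis [e]. *)
Definition ric_normsq (R : realType) (n : nat) (g : 'cV[R]_n -> 'M[R]_n)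
    (p : 'cV[R]_n) (e : 'I_n -> 'cV[R]_n) : R :=
  \sum_(a < n) \sum_(b < n) ric g p (e a) (e b) ^+ 2.

Definition riem_normsq (R : realType) (n : nat) (g : 'cV[R]_n -> 'M[R]_n)
    (p : 'cV[R]_n) (e : 'I_n -> 'cV[R]_n) : R :=
  \sum_(a < n) \sum_(b < n) \sum_(c < n) \sum_(d < n)
    riem g p (e a) (e b) (e c) (e d) ^+ 2.

(* v + z is R^(m + r), with v the first m and z the last r coordinates. *)
Definition bracket (R : realType) (m r : nat)
    (j : {linear 'cV[R]_r -> 'M[R]_m}) (u w : 'cV[R]_(m + r)) :
    'cV[R]_(m + r) :=
  col_mx 0 (\col_k dot (j (delta_mx k 0) *m usubmx u) (usubmx w)).

(* The simply connected Lie group with Lie algebra g(j), in exponential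
   coordinates: by the Campbell-Baker-Hausdorff formula for a two-step
   nilpotent algebra, exp u * exp w = exp (u + w + [u, w] / 2). *)
Definition gmul (R : realType) (m r : nat)
    (j : {linear 'cV[R]_r -> 'M[R]_m}) (p q : 'cV[R]_(m + r)) :
    'cV[R]_(m + r) :=
  p + q + 2^-1 *: bracket j p q.

Definition ginv (R : realType) (m r : nat) (p : 'cV[R]_(m + r)) :
    'cV[R]_(m + r) := - p.

(* The differential at [p] of left translation by [a]. *)
Definition dgmul (R : realType) (m r : nat)
    (j : {linear 'cV[R]_r -> 'M[R]_m}) (a p u : 'cV[R]_(m + r)) :
    'cV[R]_(m + r) :=
  'd (gmul j a) p u.

(* Gram matrix at [p] of the left invariant metric g(j): tangent vectors at
   [p] are moved to the identity by left translation by [p]^-1. *)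
Definition left_metric (R : realType) (m r : nat)
    (j : {linear 'cV[R]_r -> 'M[R]_m}) (p : 'cV[R]_(m + r)) :
    'M[R]_(m + r) :=
  \matrix_(a, b) dot (dgmul j (ginv p) p (delta_mx a 0))
                     (dgmul j (ginv p) p (delta_mx b 0)).

Definition I_aa (R : realType) (m r : nat)
    (j : {linear 'cV[R]_r -> 'M[R]_m}) (Z : 'I_r -> 'cV[R]_r) : R :=
  \sum_(a < r) \tr (j (Z a) *m j (Z a)).

(* I_(alpha alpha | beta beta) *)
Definition I_aa_bb (R : realType) (m r : nat)
    (j : {linear 'cV[R]_r -> 'M[R]_m}) (Z : 'I_r -> 'cV[R]_r) : R :=
  \sum_(a < r) \sum_(b < r)
    \tr (j (Z a) *m j (Z a)) * \tr (j (Z b) *m j (Z b)).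

(* I_(alpha alpha beta beta) *)
Definition I_aabb (R : realType) (m r : nat)
    (j : {linear 'cV[R]_r -> 'M[R]_m}) (Z : 'I_r -> 'cV[R]_r) : R :=
  \sum_(a < r) \sum_(b < r)
    \tr (j (Z a) *m j (Z a) *m (j (Z b) *m j (Z b))).

(* I_(alpha beta | alpha beta) *)
Definition I_ab_ab (R : realType) (m r : nat)
    (j : {linear 'cV[R]_r -> 'M[R]_m}) (Z : 'I_r -> 'cV[R]_r) : R :=
  \sum_(a < r) \sum_(b < r) \tr (j (Z a) *m j (Z b)) ^+ 2.

(* I_(alpha beta alpha beta) *)
Definition I_abab (R : realType) (m r : nat)
    (j : {linear 'cV[R]_r -> 'M[R]_m}) (Z : 'I_r -> 'cV[R]_r) : R :=
  \sum_(a < r) \sum_(b < r)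
    \tr (j (Z a) *m j (Z b) *m j (Z a) *m j (Z b)).

Definition Jop (R : realType) (m r : nat)
    (j : {linear 'cV[R]_r -> 'M[R]_m}) (Z : 'I_r -> 'cV[R]_r) : 'M[R]_m :=
  \sum_(a < r) j (Z a) *m j (Z a).

Lemma dotDl (R : realType) n (u v w : 'cV[R]_n) :
  dot (u + v) w = dot u w + dot v w.
Proof. by rewrite /dot -big_split; apply: eq_bigr => i _; rewrite mxE mulrDl. Qed.

Lemma dotC (R : realType) n (u v : 'cV[R]_n) : dot u v = dot v u.
Proof. by apply: eq_bigr => i _; rewrite mulrC. Qed.

Lemma dotZl (R : realType) n (a : R) (u v : 'cV[R]_n) :
  dot (a *: u) v = a * dot u v.
Proof. by rewrite /dot mulr_sumr; apply: eq_bigr => i _; rewrite mxE mulrA. Qed.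

Lemma dotE (R : realType) n (u v : 'cV[R]_n) : dot u v = (u^T *m v) 0 0.
Proof. by rewrite mxE; apply: eq_bigr => i _; rewrite mxE. Qed.

Lemma bracket_is_linear (R : realType) m r
    (j : {linear 'cV[R]_r -> 'M[R]_m}) (u : 'cV[R]_(m + r)) :
  linear (bracket j u).
Proof.
move=> a v w; rewrite /bracket scale_col_mx add_col_mx scaler0 addr0.
congr col_mx; apply/colP => k; rewrite !mxE linearP /=.
by rewrite dotC dotDl dotZl !(dotC _ (_ *m _)).
Qed.

HB.instance Definition _ (R : realType) m r
    (j : {linear 'cV[R]_r -> 'M[R]_m}) (u : 'cV[R]_(m + r)) :=
  GRing.isLinear.Build R 'cV[R]_(m + r) 'cV[R]_(m + r) _ (bracket j u)
    (bracket_is_linear j u).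

Lemma bracketC (R : realType) m r (j : {linear 'cV[R]_r -> 'M[R]_m})
    (jso : forall z, (j z)^T = - j z) (u v : 'cV[R]_(m + r)) :
  bracket j u v = - bracket j v u.
Proof.
rewrite /bracket opp_col_mx oppr0; congr col_mx; apply/colP => k; rewrite !mxE.
have mxN (A : 'M[R]_1) : (- A) 0 0 = - A 0 0 by rewrite mxE.
by rewrite dotC !dotE trmx_mul jso mulmxN mulmxA mulNmx mxN opprK.
Qed.

(* The defining relation <j_Z X, Y> = <Z, [X, Y]>. *)
Lemma bracketP (R : realType) m r (j : {linear 'cV[R]_r -> 'M[R]_m})
    (z : 'cV[R]_r) (u v : 'cV[R]_(m + r)) :
  dot (col_mx 0 z) (bracket j u v) = dot (j z *m usubmx u) (usubmx v).
Proof.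
rewrite dotE tr_col_mx mul_row_col mulmx0 add0r -dotE.
have {2}-> : z = \sum_k z k 0 *: delta_mx k 0.
  by apply/colP => i; rewrite summxE (bigD1 i) //= !mxE !eqxx mulr1 big1 ?addr0 //
     => k /negPf ki; rewrite !mxE eq_sym ki mulr0.
rewrite linear_sum mulmx_suml.
rewrite {1}/dot.
have dsum (s : seq 'I_r) (F : 'I_r -> 'cV[R]_m) w :
    dot (\sum_(k <- s) F k) w = \sum_(k <- s) dot (F k) w.
  elim: s => [|k s IH]; last by rewrite !big_cons dotDl IH.
  by rewrite !big_nil /dot big1 // => i _; rewrite mxE mul0r.
rewrite dsum; apply: eq_bigr => k _; rewrite linearZ /= -scalemxAl dotZl.
by rewrite mxE.
Qed.

Lemma usub_bracket (R : realType) m r (j : {linear 'cV[R]_r -> 'M[R]_m})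
    (u v : 'cV[R]_(m + r)) : usubmx (bracket j u v) = 0.
Proof. by rewrite col_mxKu. Qed.

Lemma bracket_central (R : realType) m r (j : {linear 'cV[R]_r -> 'M[R]_m})
    (u v w : 'cV[R]_(m + r)) : bracket j u (bracket j v w) = 0.
Proof.
rewrite /bracket col_mxKu -[RHS](@col_mx0 R m r 1); congr col_mx.
by apply/colP => k; rewrite !mxE dotC /dot big1 // => i _; rewrite mxE mul0r.
Qed.

Lemma bracketDl (R : realType) m r (j : {linear 'cV[R]_r -> 'M[R]_m})
    (u v w : 'cV[R]_(m + r)) :
  bracket j (u + v) w = bracket j u w + bracket j v w.
Proof.
rewrite /bracket add_col_mx addr0; congr col_mx; apply/colP => k.
by rewrite !mxE linearD mulmxDr dotDl.
Qed.

Lemma bracketZl (R : realType) m r (j : {linear 'cV[R]_r -> 'M[R]_m})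
    (a : R) (u w : 'cV[R]_(m + r)) :
  bracket j (a *: u) w = a *: bracket j u w.
Proof.
rewrite /bracket scale_col_mx scaler0; congr col_mx; apply/colP => k.
by rewrite !mxE linearZ /= -scalemxAr dotZl.
Qed.

Lemma bracketNl (R : realType) m r (j : {linear 'cV[R]_r -> 'M[R]_m})
    (u w : 'cV[R]_(m + r)) : bracket j (- u) w = - bracket j u w.
Proof. by rewrite -scaleN1r bracketZl scaleN1r. Qed.

Lemma bracket_centrall (R : realType) m r (j : {linear 'cV[R]_r -> 'M[R]_m})
    (u v w : 'cV[R]_(m + r)) : bracket j (bracket j u v) w = 0.
Proof.
rewrite {1}/bracket usub_bracket -[RHS](@col_mx0 R m r 1); congr col_mx.
by apply/colP => k; rewrite !mxE mulmx0 /dot big1 // => i _; rewrite mxE mul0r.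
Qed.

Lemma gmulA (R : realType) m r (j : {linear 'cV[R]_r -> 'M[R]_m}) :
  associative (gmul j).
Proof.
move=> p q s; rewrite /gmul !linearD !bracketDl !linearZ !bracketZl /=.
rewrite bracket_central bracket_centrall !scaler0 !addr0 !scalerDr.
by rewrite !addrA [LHS](ACl (1*2*5*3*6*4))/=.
Qed.

Lemma gmul0p (R : realType) m r (j : {linear 'cV[R]_r -> 'M[R]_m}) :
  left_id 0 (gmul j).
Proof.
move=> p; rewrite /gmul add0r -(scale0r p) bracketZl scale0r scaler0.
by rewrite addr0.
Qed.

Lemma gmulp0 (R : realType) m r (j : {linear 'cV[R]_r -> 'M[R]_m}) :
  right_id 0 (gmul j).
Proof. by move=> p; rewrite /gmul linear0 scaler0 !addr0. Qed.

Lemma bracketpp (R : realType) m r (j : {linear 'cV[R]_r -> 'M[R]_m})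
    (jso : forall z, (j z)^T = - j z) (p : 'cV[R]_(m + r)) : bracket j p p = 0.
Proof.
have h := bracketC jso p p.
have /eqP : 2%:R *: bracket j p p = 0 by rewrite scaler_nat mulr2n {1}h addNr.
by rewrite scaler_eq0 pnatr_eq0 /= => /eqP.
Qed.

Lemma gmulNp (R : realType) m r (j : {linear 'cV[R]_r -> 'M[R]_m})
    (jso : forall z, (j z)^T = - j z) : left_inverse 0 (@ginv R m r) (gmul j).
Proof.
move=> p; rewrite /gmul /ginv addNr add0r bracketNl bracketpp //.
by rewrite oppr0 scaler0.
Qed.

Lemma gmulpN (R : realType) m r (j : {linear 'cV[R]_r -> 'M[R]_m})
    (jso : forall z, (j z)^T = - j z) : right_inverse 0 (@ginv R m r) (gmul j).
Proof.
by move=> p; rewrite /gmul /ginv subrr add0r linearN /= bracketpp // oppr0 scaler0.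
Qed.

Lemma linear_cV_differentiable (R : realType) n k
    (f : {linear 'cV[R]_n -> 'cV[R]_k}) (p : 'cV[R]_n) :
  differentiable f p /\ 'd f p = f :> (_ -> _).
Proof.
suff fc : continuous f.
  by split; [exact: linear_differentiable | exact: diff_lin].
have -> : (f : _ -> _) = fun x => \sum_(i < n) x i 0 *: f (delta_mx i 0).
  apply/funext => x; rewrite {1}[x]matrix_sum_delta linear_sum /=.
  by apply: eq_bigr => i _; rewrite big_ord1 linearZ.
apply: continuous_big => [|i _ y]; first exact: add_continuous.
apply: (@cvgZr_tmp _ _ _ (nbhs y) _ (fun x : 'cV[R]_n => x i 0)).
exact: (@coord_continuous R n 1 i 0 y).
Qed.

Lemma diff_affine (R : realType) n k (f : {linear 'cV[R]_n -> 'cV[R]_k})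
    (g : 'cV[R]_n -> 'cV[R]_k) (a : 'cV[R]_k) (p u : 'cV[R]_n) :
  (forall x, g x = a + f x) -> 'd g p u = f u.
Proof.
move=> ge; have -> : g = cst a + f by apply/funext => x; rewrite ge.
have [fd fdf] := linear_cV_differentiable f p.
have dD : 'd (cst a + f) p = 'd (cst a) p \+ 'd f p :> (_ -> _).
  by apply: diffD; [exact: differentiable_cst | exact: fd].
have c0 : 'd (cst a) p = 0 :> ('cV[R]_n -> 'cV[R]_k) := @diff_cst _ _ _ a p.
have := congr1 (@^~ u) dD; have /= := congr1 (@^~ u) c0.
move=> c0u dDu; apply: (etrans dDu); apply: (etrans (congr2 +%R c0u (congr1 (@^~ u) fdf))).
exact: add0r.
Qed.

Lemma dgmulE (R : realType) m r (j : {linear 'cV[R]_r -> 'M[R]_m})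
    (a p u : 'cV[R]_(m + r)) : dgmul j a p u = u + 2^-1 *: bracket j a u.
Proof.
pose L : {linear 'cV[R]_(m + r) -> 'cV[R]_(m + r)} :=
  (idfun \+ (2^-1 \*: bracket j a))%R.
by rewrite /dgmul (@diff_affine _ _ _ L _ a) // => q; rewrite /gmul /L /= addrA.
Qed.

(* The left invariant vector field with value [u] at the identity. *)
Definition left_field (R : realType) (m r : nat)
    (j : {linear 'cV[R]_r -> 'M[R]_m}) (u p : 'cV[R]_(m + r)) :
    'cV[R]_(m + r) :=
  dgmul j p 0 u.

(* The Lie algebra of G(j) is g(j): the commutator of the left invariant
   fields of [u] and [w], computed in the chart, is that of [u, w]. *)
Lemma left_field_bracket (R : realType) m r
    (j : {linear 'cV[R]_r -> 'M[R]_m}) (jso : forall z, (j z)^T = - j z)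
    (u w p : 'cV[R]_(m + r)) :
  'd (left_field j w) p (left_field j u p)
    - 'd (left_field j u) p (left_field j w p)
  = left_field j (bracket j u w) p.
Proof.
have dE a b : 'd (left_field j a) p b = 2^-1 *: bracket j b a.
  pose L : {linear 'cV[R]_(m + r) -> 'cV[R]_(m + r)} :=
    ((- 2^-1) \*: bracket j a)%R.
  rewrite (@diff_affine _ _ _ L _ a) => [|x].
    by rewrite /L /= (bracketC jso) scaleNr scalerN opprK.
  by rewrite /left_field dgmulE /L /= (bracketC jso) scalerN scaleNr.
apply: etrans (congr2 (fun x y => x - y) (dE _ _) (dE _ _)) _.
rewrite /left_field.
rewrite !(dgmulE j p 0) !bracketDl !bracketZl !bracket_centrall.
rewrite bracket_central !scaler0 !addr0 (bracketC jso w u) scalerN opprK.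
have h : 2^-1 + 2^-1 = 1 :> R by rewrite [RHS](splitr 1) !mul1r.
by rewrite -scalerDl h scale1r.
Qed.

Lemma linear_cV_mx (R : realType) n k (f : {linear 'cV[R]_n -> 'cV[R]_k})
    (u : 'cV[R]_n) : f u = (\matrix_(a, b) f (delta_mx b 0) a 0) *m u.
Proof.
rewrite {1}[u]matrix_sum_delta linear_sum /=; apply/colP => a.
rewrite summxE mxE; apply: eq_bigr => b _.
by rewrite big_ord1 linearZ !mxE mulrC.
Qed.

Lemma inner_left_metric (R : realType) m r
    (j : {linear 'cV[R]_r -> 'M[R]_m}) (p u v : 'cV[R]_(m + r)) :
  inner (left_metric j) p u v
  = dot (dgmul j (ginv p) p u) (dgmul j (ginv p) p v).
Proof.
pose L : {linear 'cV[R]_(m + r) -> 'cV[R]_(m + r)} :=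
  (idfun \+ (2^-1 \*: bracket j (ginv p)))%R.
have LE x : dgmul j (ginv p) p x = L x by rewrite dgmulE.
pose A := \matrix_(a, b) L (delta_mx b 0) a 0.
have gE : left_metric j p = A^T *m A.
  apply/matrixP => a b; rewrite !mxE !LE; apply: eq_bigr => k _.
  by rewrite !mxE.
by rewrite !LE !(linear_cV_mx L) dotE trmx_mul /inner gE !mulmxA.
Qed.

Lemma left_metric_invariant (R : realType) m r
    (j : {linear 'cV[R]_r -> 'M[R]_m}) (jso : forall z, (j z)^T = - j z)
    (a p u v : 'cV[R]_(m + r)) :
  inner (left_metric j) (gmul j a p) (dgmul j a p u) (dgmul j a p v)
  = inner (left_metric j) p u v.
Proof.
suff h x : dgmul j (ginv (gmul j a p)) (gmul j a p) (dgmul j a p x)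
           = dgmul j (ginv p) p x.
  by rewrite !inner_left_metric !h.
rewrite !dgmulE /ginv /gmul linearD linearZ /= bracket_central scaler0 addr0.
rewrite !bracketNl !bracketDl bracketZl bracket_centrall scaler0 addr0.
by rewrite opprD scalerDr !scalerN -addrA (addrA (_ *: _)) subrr add0r.
Qed.

(* The left invariant frame is orthonormal at every point. *)
Lemma left_field_orthonormal (R : realType) m r
    (j : {linear 'cV[R]_r -> 'M[R]_m}) (jso : forall z, (j z)^T = - j z)
    (p : 'cV[R]_(m + r)) :
  orthonormal_basis (inner (left_metric j) p)
    (fun a => left_field j (delta_mx a 0) p).
Proof.
have h x : dgmul j (ginv p) p (left_field j x p) = x.
  rewrite /left_field !dgmulE linearD linearZ /= bracket_central scaler0 addr0.
  by rewrite /ginv bracketNl scalerN addrK.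
move=> a b; rewrite inner_left_metric !h /dot (bigD1 a) //= big1 => [|c /negPf ca].
  by rewrite !mxE !eqxx mul1r addr0 andbT.
by rewrite !mxE ca /= mul0r.
Qed.

(* Main.v *)
From HB Require Import structures.
Require Import Defs.
From mathcomp Require Import all_boot all_order all_algebra.
From mathcomp Require Import boolp classical_sets functions reals.
From mathcomp Require Import topology normedtype derive.
From mathcomp Require Import ring lra.

(** In exponential coordinates the left invariant metric is [g = A^T A], where
    [A q = 1 - ad q / 2] moves tangent vectors at [q] to the Lie algebra. As
    [ad] is linear, [A] is affine in [q]; as the algebra is two-step nilpotent,
    [ad p *m ad q = 0], so that [A q] has inverse [C q = 1 + ad q / 2] and the
    partial derivatives [D_a = - ad (e_a) / 2] of [A] are constant matrices
    absorbed by [A] and [C] on either side.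

    Let [conn u] be the matrix of the Levi-Civita connection [nabla_u] on left
    invariant fields, that is
    [nabla_(X,Z) (Y,W) = (- j_Z Y - j_W X, [X,Y]) / 2]. Koszul's formula and
    the gauge change to the coordinate frame give the Christoffel symbols as
    the matrices [C * conn (A e_a) * A + D_a] ([christoffelE]). Differentiating
    this explicit polynomial expression, the gauge terms cancel and the
    coordinate curvature is [C * K(A e_a, A e_b) * A] ([riem_coefE]), where
    [K(x,y) = [conn x, conn y] - conn [x,y]] is the curvature on the Lie
    algebra and no longer depends on the point.

    A frame orthonormal for [g p] is carried by [A p] to an orthonormal basis
    of R^(m+r), and a sum of the values of a bilinear map on the diagonal of an
    orthonormal basis does not depend on that basis ([sum_onb]). The three
    invariants therefore become sums over the standard basis of v + z, and the
    invariants of [j] may likewise be computed with the standard basis of z.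

    There [K] splits into blocks. For X, Y in v and Z, W in z:
    - K(X,Y) preserves v and z. Its z-block has, by pair symmetry, the same
      total square as the K(Z,W); its v-block is a combination of three index
      permutations of [S_abcd = \sum_k (j_k)_ab (j_k)_cd];
    - K(X,Z) exchanges v and z, with blocks built from products [j_k j_l];
    - K(Z,W) is [[j_Z, j_W] / 4] on v and zero on z.

    The squares of the three terms of the v-block contribute [3/8] of
    [\sum S_abcd^2], which is the invariant I_(ab|ab) of [j], and their
    cross terms contribute [3/8] of I_(abab) after reorienting 4-cycles
    by skew-symmetry ([sum_quartic]). The other blocks contribute
    [Tr J^2 / 2 - I_(abab) / 4]. Tracing [K] gives the Ricci tensor,
    [J / 2] on v and [- Tr (j_Z j_W) / 4] on z, whence the scalar curvature and
    the norm of the Ricci tensor. *)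

Import Order.TTheory GRing.Theory Num.Theory.
Import numFieldNormedType.Exports.

Local Open Scope ring_scope.

Set Implicit Arguments.
Unset Strict Implicit.
Unset Printing Implicit Defensive.

(** * Multilinear algebra over column vectors *)

Lemma dotNl (R : realType) n (u v : 'cV[R]_n) : dot (- u) v = - dot u v.
Proof. by rewrite -scaleN1r dotZl mulN1r. Qed.

Lemma dot0l (R : realType) n (u : 'cV[R]_n) : dot 0 u = 0.
Proof. by rewrite -(scale0r 0) dotZl mul0r. Qed.

Lemma linear_expand (R : realType) n (V : lmodType R) (f : 'cV[R]_n -> V)
    (lf : linear f) (u : 'cV[R]_n) :
  f u = \sum_(a < n) u a 0 *: f (delta_mx a 0).
Proof.
pose F : {linear 'cV[R]_n -> V} := HB.pack f (GRing.isLinear.Build _ _ _ _ f lf).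
rewrite -[f]/(F : _ -> _) {1}[u]matrix_sum_delta linear_sum.
by apply: eq_bigr => a _; rewrite big_ord1 linearZ.
Qed.

Lemma mulmx_cVP (R : pzRingType) s t (M N : 'M[R]_(s, t)) :
  (forall u : 'cV_t, M *m u = N *m u) -> M = N.
Proof.
move=> MN; apply/matrixP => a b.
by have := congr1 (fun w : 'cV_s => w a 0) (MN (delta_mx b 0)); rewrite -!colE !mxE.
Qed.

(** With [M] the matrix whose columns are the [f a], the coefficient on the
    right is the entry [i, k] of [M M^T]. Taking [M^T M = 1] gives [sum_onb];
    taking [M M^T] the inverse Gram matrix gives the trace with respect to
    a metric ([scalE]). *)
Lemma sum_quadratic (R : realType) n (V : lmodType R)
    (b : 'cV[R]_n -> 'cV[R]_n -> V) (f : 'I_n -> 'cV[R]_n) :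
  (forall y, linear (b^~ y)) -> (forall x, linear (b x)) ->
  \sum_(a < n) b (f a) (f a) =
  \sum_(i < n) \sum_(k < n)
    (\sum_(a < n) f a i 0 * f a k 0) *: b (delta_mx i 0) (delta_mx k 0).
Proof.
move=> bl br.
under eq_bigr => a _.
  rewrite (linear_expand (bl (f a))).
  under eq_bigr => i _ do rewrite (linear_expand (br _)) scaler_sumr.
  over.
rewrite exchange_big; apply: eq_bigr => i _.
rewrite exchange_big; apply: eq_bigr => k _.
by rewrite scaler_suml; apply: eq_bigr => a _; rewrite scalerA.
Qed.

(** A square matrix with orthonormal columns has orthonormal rows, so the
    coefficients in [sum_quadratic] are those of the identity. The values of
    [b] may lie in any module, which also covers sums of matrices such as
    [Jop]. *)
Lemma sum_onb (R : realType) n (V : lmodType R)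
    (b : 'cV[R]_n -> 'cV[R]_n -> V) (f : 'I_n -> 'cV[R]_n) :
  (forall y, linear (b^~ y)) -> (forall x, linear (b x)) ->
  orthonormal_basis (@dot R n) f ->
  \sum_(a < n) b (f a) (f a) = \sum_(i < n) b (delta_mx i 0) (delta_mx i 0).
Proof.
move=> bl br fon; rewrite sum_quadratic //.
pose E := \matrix_(i, a) f a i 0 : 'M[R]_n.
have EtE : E^T *m E = 1%:M.
  apply/matrixP => a c; rewrite !mxE -fon.
  by apply: eq_bigr => i _; rewrite !mxE.
have EEt i k : \sum_(a < n) f a i 0 * f a k 0 = (i == k)%:R.
  have := congr1 (fun M : 'M_n => M i k) (mulmx1C EtE); rewrite !mxE => <-.
  by apply: eq_bigr => a _; rewrite !mxE.
apply: eq_bigr => i _; under eq_bigr do rewrite EEt.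
rewrite (bigD1 i) //= eqxx scale1r big1 ?addr0 // => k /negPf ki.
by rewrite eq_sym ki scale0r.
Qed.

Lemma sum_sqr_onb (R : realType) n (f : 'I_n -> 'cV[R]_n)
    (phi : 'cV[R]_n -> R^o) :
  linear phi -> orthonormal_basis (@dot R n) f ->
  \sum_(a < n) phi (f a) ^+ 2 = \sum_(a < n) phi (delta_mx a 0) ^+ 2.
Proof.
move=> lphi fon.
apply: (@sum_onb _ _ R^o (fun x y => phi x * phi y)) => // x h y z.
  by rewrite lphi mulrDl scalerAl.
by rewrite lphi mulrDr scalerAr.
Qed.

Lemma sum_sqr_onb2 (R : realType) n (f : 'I_n -> 'cV[R]_n)
    (phi : 'cV[R]_n -> 'cV[R]_n -> R^o) :
  (forall y, linear (phi^~ y)) -> (forall x, linear (phi x)) ->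
  orthonormal_basis (@dot R n) f ->
  \sum_(a < n) \sum_(b < n) phi (f a) (f b) ^+ 2 =
  \sum_(a < n) \sum_(b < n) phi (delta_mx a 0) (delta_mx b 0) ^+ 2.
Proof.
move=> ll lr fon; under eq_bigr do rewrite (sum_sqr_onb (lr _) fon).
rewrite exchange_big; under eq_bigr do rewrite (sum_sqr_onb (ll _) fon).
exact: exchange_big.
Qed.

Lemma exchange_sum4 (R : nmodType) n s (F : 'I_n -> 'I_n -> 'I_s -> 'I_s -> R) :
  \sum_(a < n) \sum_(b < n) \sum_(c < s) \sum_(d < s) F a b c d =
  \sum_(c < s) \sum_(d < s) \sum_(a < n) \sum_(b < n) F a b c d.
Proof.
under eq_bigr do rewrite exchange_big; rewrite exchange_big /=.
apply: eq_bigr => c _; under eq_bigr do rewrite exchange_big.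
by rewrite exchange_big.
Qed.

(** The trace of [C f A] is that of [f], here with each trace taken column by
    column as in the definition of the Ricci tensor. *)
Lemma trace_similar (R : realType) n (A C : 'M[R]_n) (f : 'cV[R]_n -> 'cV[R]_n) :
  linear f -> A *m C = 1%:M ->
  \sum_(a < n) (C *m f (A *m delta_mx a 0)) a 0 = \sum_(a < n) f (delta_mx a 0) a 0.
Proof.
move=> lf AC.
pose F : {linear 'cV[R]_n -> 'cV[R]_n} :=
  HB.pack f (GRing.isLinear.Build _ _ _ _ f lf).
pose M : 'M[R]_n := \matrix_(a, b) f (delta_mx b 0) a 0.
have fE u : f u = M *m u := linear_cV_mx F u.
transitivity (\tr (C *m (M *m A))).
  by apply: eq_bigr => a _; rewrite fE !mulmxA -colE mxE.
rewrite mxtrace_mulC -mulmxA AC mulmx1.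
by apply: eq_bigr => a _; rewrite mxE.
Qed.

Lemma mulmxZDl (R : pzRingType) s t w (h : R) (M N : 'M[R]_(s, t)) (P : 'M[R]_(t, w)) :
  (h *: M + N) *m P = h *: (M *m P) + N *m P.
Proof. by rewrite mulmxDl -scalemxAl. Qed.

Lemma mulmxZDr (R : comPzRingType) s t w (h : R) (M N : 'M[R]_(t, w)) (P : 'M[R]_(s, t)) :
  P *m (h *: M + N) = h *: (P *m M) + P *m N.
Proof. by rewrite mulmxDr -scalemxAr. Qed.

(** [curv_op] is defined by its components in the coordinate basis; this
    rebuilds its values from them. *)
Lemma trilinear_expand (R : realType) n (A C : 'M[R]_n)
    (K : 'cV[R]_n -> 'cV[R]_n -> 'M[R]_n) (u v w : 'cV[R]_n) k :
  (forall y, linear (K^~ y)) -> (forall x, linear (K x)) ->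
  (C *m (K (A *m u) (A *m v) *m (A *m w))) k 0 =
  \sum_(a < n) \sum_(b < n) \sum_(c < n)
    (C *m K (A *m delta_mx a 0) (A *m delta_mx b 0) *m A) k c
    * u a 0 * v b 0 * w c 0.
Proof.
move=> Kl Kr; pose F u v := C *m K (A *m u) (A *m v) *m A.
have Fl y : linear (F^~ y).
  move=> h s t; rewrite /F mulmxZDr Kl.
  by rewrite mulmxZDr mulmxZDl.
have Fr x : linear (F x).
  move=> h s t; rewrite /F mulmxZDr Kr.
  by rewrite mulmxZDr mulmxZDl.
rewrite mulmxA mulmxA -/(F u v).
rewrite (linear_expand (Fl v)) mulmx_suml summxE; apply: eq_bigr => a _.
rewrite (linear_expand (Fr _)) -scalemxAl mulmx_suml [LHS]mxE summxE mulr_sumr.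
apply: eq_bigr => b _; rewrite -scalemxAl [X in _ * X]mxE [X in _ * (_ * X)]mxE.
by rewrite !mulr_sumr; apply: eq_bigr => c _; rewrite /F; ring.
Qed.

(** * Derivatives of matrix-valued functions *)

(** Entrywise, since the coefficients of the metric and of the connection are
    differentiated entry by entry. *)
Definition mx_is_derive (R : realType) {n s t : nat} (p v : 'cV[R]_n)
    (F : 'cV[R]_n -> 'M[R]_(s, t)) (dF : 'M[R]_(s, t)) : Prop :=
  forall i k, is_derive p v (fun q => F q i k) (dF i k).

(** Along a line the difference quotient is constant off zero. *)
Lemma is_derive_affine (R : realType) n (p v : 'cV[R]_n) (f : 'cV[R]_n -> R)
    (d : R) :
  (forall h, f (h *: v + p) = h * d + f p) -> is_derive p v f d.
Proof.
move=> fE.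
have dcvg : (h^-1 *: (f (h *: v + p) - f p) @[h --> 0^'] --> d)%classic.
  apply: cvg_near_cst; near=> h.
  have h0 : h != 0 by near: h; exact: nbhs_dnbhs_neq.
  by rewrite fE addrK /GRing.scale /= mulKf.
split; first by apply/cvg_ex; exists d.
exact: cvg_lim.
Unshelve. all: by end_near.
Qed.

Lemma mx_is_derive_affine (R : realType) n s t (p v : 'cV[R]_n)
    (F : 'cV[R]_n -> 'M[R]_(s, t)) (dF : 'M[R]_(s, t)) :
  (forall h, F (h *: v + p) = h *: dF + F p) -> mx_is_derive p v F dF.
Proof. by move=> FE i k; apply: is_derive_affine => h; rewrite FE !mxE. Qed.

Lemma mx_is_deriveD (R : realType) n s t (p v : 'cV[R]_n)
    (F G : 'cV[R]_n -> 'M[R]_(s, t)) (dF dG : 'M[R]_(s, t)) :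
  mx_is_derive p v F dF -> mx_is_derive p v G dG ->
  mx_is_derive p v (fun q => F q + G q) (dF + dG).
Proof.
move=> hF hG i k; rewrite mxE.
have -> : (fun q => (F q + G q) i k) = (fun q => F q i k) + (fun q => G q i k).
  by apply/funext => q; rewrite mxE.
exact: is_deriveD.
Qed.

Lemma mx_is_deriveM (R : realType) n s t w (p v : 'cV[R]_n)
    (F : 'cV[R]_n -> 'M[R]_(s, t)) (G : 'cV[R]_n -> 'M[R]_(t, w))
    (dF : 'M[R]_(s, t)) (dG : 'M[R]_(t, w)) :
  mx_is_derive p v F dF -> mx_is_derive p v G dG ->
  mx_is_derive p v (fun q => F q *m G q) (dF *m G p + F p *m dG).
Proof.
move=> hF hG i k.
have -> : (fun q => (F q *m G q) i k) =
    \sum_(l < t) ((fun q => F q i l) * (fun q => G q l k)).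
  by apply/funext => q; rewrite mxE fct_sumE.
have -> : (dF *m G p + F p *m dG) i k =
    \sum_(l < t) (F p i l *: dG l k + G p l k *: dF i l).
  rewrite !mxE -big_split; apply: eq_bigr => l _.
  by rewrite /GRing.scale /= addrC [dF _ _ * _]mulrC.
by apply: is_derive_sum => l; apply: is_deriveM.
Qed.

Lemma mx_is_derive_tr (R : realType) n s t (p v : 'cV[R]_n)
    (F : 'cV[R]_n -> 'M[R]_(s, t)) (dF : 'M[R]_(s, t)) :
  mx_is_derive p v F dF -> mx_is_derive p v (fun q => (F q)^T) dF^T.
Proof.
move=> hF i k; rewrite mxE.
by have -> : (fun q => (F q)^T i k) = (fun q => F q k i)
  by apply/funext => q; rewrite mxE.
Qed.

(** * The left invariant frame and its connection *)

Section LeftInvariantConnection.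
Variables (R : realType) (m r : nat) (j : {linear 'cV[R]_r -> 'M[R]_m}).
Hypothesis jso : forall z, (j z)^T = - j z.

Definition ad (q : 'cV[R]_(m + r)) : 'M[R]_(m + r) :=
  \matrix_(a, b) bracket j q (delta_mx b 0) a 0.

Lemma adE q u : ad q *m u = bracket j q u.
Proof. by rewrite (linear_cV_mx (bracket j q)). Qed.

Lemma ad_is_linear : linear ad.
Proof.
move=> h u v; apply: mulmx_cVP => w.
by rewrite mulmxDl -scalemxAl !adE bracketDl bracketZl.
Qed.

HB.instance Definition _ :=
  GRing.isLinear.Build R 'cV[R]_(m + r) 'M[R]_(m + r) _ ad ad_is_linear.

(** This is two-step nilpotency; all the simplifications below come from it. *)
Lemma ad_ad p q : ad p *m ad q = 0.
Proof.
by apply: mulmx_cVP => u; rewrite -mulmxA !adE bracket_central mul0mx.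
Qed.

(** The differential at [q] of left translation by the inverse of [q]
    ([dgmul_inv_coframe]). The columns of its inverse [frame q] are the left
    invariant fields at [q]. *)
Definition coframe (q : 'cV[R]_(m + r)) : 'M[R]_(m + r) :=
  1%:M - 2^-1 *: ad q.
Definition frame (q : 'cV[R]_(m + r)) : 'M[R]_(m + r) :=
  1%:M + 2^-1 *: ad q.

Lemma mul_ad_coframe p q : ad p *m coframe q = ad p.
Proof. by rewrite mulmxBr mulmx1 -scalemxAr ad_ad scaler0 subr0. Qed.
Lemma mul_coframe_ad p q : coframe q *m ad p = ad p.
Proof. by rewrite mulmxBl mul1mx -scalemxAl ad_ad scaler0 subr0. Qed.
Lemma mul_ad_frame p q : ad p *m frame q = ad p.
Proof. by rewrite mulmxDr mulmx1 -scalemxAr ad_ad scaler0 addr0. Qed.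
Lemma mul_frame_ad p q : frame q *m ad p = ad p.
Proof. by rewrite mulmxDl mul1mx -scalemxAl ad_ad scaler0 addr0. Qed.

Lemma mul_coframe_frame q : coframe q *m frame q = 1%:M.
Proof. by rewrite mulmxBl mul1mx -scalemxAl mul_ad_frame addrK. Qed.
Lemma mul_frame_coframe q : frame q *m coframe q = 1%:M.
Proof. by rewrite mulmxDl mul1mx -scalemxAl mul_ad_coframe subrK. Qed.

Lemma dgmul_inv_coframe q u : dgmul j (ginv q) q u = coframe q *m u.
Proof.
by rewrite dgmulE mulmxBl mul1mx -scalemxAl adE /ginv bracketNl scalerN.
Qed.

Lemma left_metricE q : left_metric j q = (coframe q)^T *m coframe q.
Proof.
apply/matrixP => a b; rewrite mxE !dgmul_inv_coframe -!colE.
move: (coframe q) => A; rewrite mxE; apply: eq_bigr => k _.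
by rewrite !mxE.
Qed.

Lemma invmx_left_metric q :
  invmx (left_metric j q) = frame q *m (frame q)^T.
Proof.
have gC : left_metric j q *m (frame q *m (frame q)^T) = 1%:M.
  rewrite left_metricE mulmxA -[_ *m frame q]mulmxA mul_coframe_frame mulmx1.
  by rewrite -trmx_mul mul_frame_coframe trmx1.
have gu := proj1 (mulmx1_unit gC).
by rewrite -[LHS]mulmx1 -gC mulKmx.
Qed.

(** [coframe q] changes vectors by central ones only. *)
Lemma bracket_coframe q u v :
  bracket j (coframe q *m u) (coframe q *m v) = bracket j u v.
Proof.
rewrite !mulmxBl !mul1mx -!scalemxAl !adE -scaleNr -[- (_ *: bracket j q v)]scaleNr.
rewrite linearD linearZ /= bracket_central scaler0 addr0.
by rewrite bracketDl bracketZl bracket_centrall scaler0 addr0.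
Qed.

(** The derivative of [coframe] in the direction [v], the same at every
    point. *)
Definition dcoframe (v : 'cV[R]_(m + r)) := - (2^-1 *: ad v).

Lemma coframe_affine h v q : coframe (h *: v + q) = h *: dcoframe v + coframe q.
Proof.
rewrite /coframe /dcoframe linearP /= scalerDr !scalerA mulrC -scalerA opprD.
by rewrite scalerN addrCA addrA.
Qed.

Lemma frame_affine h v q : frame (h *: v + q) = h *: - dcoframe v + frame q.
Proof.
rewrite /frame /dcoframe linearP /= scalerDr !scalerA mulrC -scalerA opprK.
by rewrite addrCA addrA.
Qed.

Lemma mx_is_derive_coframe p v : mx_is_derive p v coframe (dcoframe v).
Proof. by apply: mx_is_derive_affine => h; rewrite coframe_affine. Qed.

Lemma mx_is_derive_frame p v : mx_is_derive p v frame (- dcoframe v).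
Proof. by apply: mx_is_derive_affine => h; rewrite frame_affine. Qed.

Lemma mul_coframe_dcoframe v q : coframe q *m dcoframe v = dcoframe v.
Proof. by rewrite mulmxN -scalemxAr mul_coframe_ad. Qed.
Lemma mul_dcoframe_frame v q : dcoframe v *m frame q = dcoframe v.
Proof. by rewrite mulNmx -scalemxAl mul_ad_frame. Qed.
Lemma mul_dcoframe_dcoframe v w : dcoframe v *m dcoframe w = 0.
Proof. by rewrite mulmxN mulNmx opprK -scalemxAl -scalemxAr ad_ad !scaler0. Qed.

(** The block of [ad u] from v to z; its transpose is [Z |-> j_Z X], with [X]
    the v-component of [u] ([mul_tr_half_ad]). *)
Definition half_ad (u : 'cV[R]_(m + r)) : 'M[R]_(r, m) :=
  \matrix_(k, b) (j (delta_mx k 0) *m usubmx u) b 0.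

Lemma half_ad_is_linear : linear half_ad.
Proof.
move=> h u v; apply/matrixP => k b.
by rewrite mxE linearP /= mulmxDr -scalemxAr !mxE.
Qed.

HB.instance Definition _ :=
  GRing.isLinear.Build R 'cV[R]_(m + r) 'M[R]_(r, m) _ half_ad half_ad_is_linear.

Lemma mul_half_ad u w : half_ad u *m usubmx w = dsubmx (bracket j u w).
Proof.
apply/colP => k; rewrite /bracket col_mxKd !mxE.
by apply: eq_bigr => b _; rewrite mxE.
Qed.

Lemma mul_tr_half_ad u z : (half_ad u)^T *m z = j z *m usubmx u.
Proof.
have lf : linear (fun z => j z *m usubmx u).
  by move=> h x y; rewrite linearP mulmxDl -scalemxAl.
rewrite (linear_expand lf); apply/colP => b; rewrite summxE mxE.
by apply: eq_bigr => k _; rewrite !mxE mulrC.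
Qed.

(** The matrix of [nabla_u] on left invariant fields. It is skew because
    the [j_Z] are, as befits a metric connection. *)
Definition conn (u : 'cV[R]_(m + r)) : 'M[R]_(m + r) :=
  2^-1 *: block_mx (- j (dsubmx u)) (- (half_ad u)^T) (half_ad u) 0.

Lemma conn_is_linear : linear conn.
Proof.
move=> h u v; rewrite /conn !linearP /= [h *: (2^-1 *: _)]scalerA mulrC -scalerA.
rewrite -scalerDr; congr (_ *: _); rewrite scale_block_mx add_block_mx.
by rewrite scaler0 addr0.
Qed.

HB.instance Definition _ :=
  GRing.isLinear.Build R 'cV[R]_(m + r) 'M[R]_(m + r) _ conn conn_is_linear.

Lemma koszul u v w :
  dot (conn u *m v) w =
  2^-1 * (dot (bracket j u v) w - dot (bracket j v w) u + dot (bracket j w u) v).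
Proof.
have dot_bracket x y z : dot (bracket j x y) z = dot (j (dsubmx z) *m usubmx x) (usubmx y).
  rewrite -bracketP dotC /bracket -{1}[z]vsubmxK !dotE !tr_col_mx !mul_row_col.
  by rewrite !mulmx0 !add0r.
have jskew z (x y : 'cV_m) : dot (j z *m x) y = - dot x (j z *m y).
  by rewrite !dotE trmx_mul jso mulmxN mulNmx mxE mulmxA.
have dsplit (x y : 'cV_(m + r)) :
    dot x y = dot (usubmx x) (usubmx y) + dot (dsubmx x) (dsubmx y).
  by rewrite -{1}[x]vsubmxK -{1}[y]vsubmxK !dotE tr_col_mx mul_row_col mxE.
rewrite [in LHS]/conn -scalemxAl dotZl; congr (_ * _).
rewrite -{1}[v]vsubmxK mul_block_col mul0mx addr0 mul_half_ad.
rewrite dsplit col_mxKu col_mxKd !mulNmx mul_tr_half_ad.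
rewrite dotDl !dotNl (dsplit _ (bracket j u v) w) usub_bracket dot0l add0r.
rewrite (dot_bracket w u v) (dot_bracket v w u) (jskew _ (usubmx w)).
by rewrite (dotC (usubmx w)); ring.
Qed.

End LeftInvariantConnection.

(** * Curvature in the left invariant frame *)

(** Gauge covariance of the curvature, for a frame change [A] with inverse
    [C] and constant derivatives [D], [E] in two directions. [X], [Y] are the
    connection matrices in the new frame and [U], [V] the derivatives of [Y]
    and [X]; the first two lines on the left are the derivatives of
    [C Y A + E] and [C X A + D]. The absorption hypotheses leave in each
    product of connection matrices exactly the terms that cancel the
    derivatives of [A] and [C]. *)
Lemma curvature_gauge_change (R : comNzRingType) n (A C D E X Y U V : 'M[R]_n) :
  A *m C = 1%:M -> A *m D = D -> A *m E = E -> D *m C = D -> E *m C = E ->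
  D *m E = 0 -> E *m D = 0 ->
  (- D *m Y *m A + C *m U *m A + C *m Y *m D)
  - (- E *m X *m A + C *m V *m A + C *m X *m E)
  + ((C *m X *m A + D) *m (C *m Y *m A + E)
     - (C *m Y *m A + E) *m (C *m X *m A + D))
  = C *m (X *m Y - Y *m X + (U - V)) *m A.
Proof.
move=> AC AD AE DC EC DE ED.
have prod (S T F G : 'M[R]_n) : F *m C = F -> A *m G = G -> F *m G = 0 ->
    (C *m S *m A + F) *m (C *m T *m A + G)
    = C *m (S *m T) *m A + C *m S *m G + F *m T *m A.
  move=> FC AG FG; rewrite mulmxDl !mulmxDr FG addr0 -!mulmxA AG.
  by rewrite (mulmxA A C) AC mul1mx (mulmxA F C) FC.
rewrite !prod // !mulNmx !mulmxDr !mulmxN !mulmxDl !mulNmx.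
have addE (M N : 'M[R]_n) i k : (M + N) i k = M i k + N i k by rewrite mxE.
have oppE (M : 'M[R]_n) i k : (- M) i k = - M i k by rewrite mxE.
by apply/matrixP => i k; rewrite !(addE, oppE); ring.
Qed.

Section Curvature.
Variables (R : realType) (m r : nat) (j : {linear 'cV[R]_r -> 'M[R]_m}).
Hypothesis jso : forall z, (j z)^T = - j z.

(** The connection matrix of [nabla_u] in coordinates: the usual term
    [C * dA(u)] of a gauge change is [dcoframe u] itself, as [C] fixes it. *)
Definition gauge_christoffel (u q : 'cV[R]_(m + r)) : 'M[R]_(m + r) :=
  frame j q *m conn j (coframe j q *m u) *m coframe j q + dcoframe j u.

Lemma pderiv_left_metric (s t a : 'I_(m + r)) q :
  pderiv (fun q => left_metric j q s t) a q =
  - 2^-1 * (dot (bracket j (delta_mx a 0) (delta_mx s 0)) (coframe j q *m delta_mx t 0)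
          + dot (bracket j (delta_mx a 0) (delta_mx t 0)) (coframe j q *m delta_mx s 0)).
Proof.
rewrite /pderiv; set v := delta_mx a 0.
have := mx_is_deriveM (mx_is_derive_tr (mx_is_derive_coframe j q v))
  (mx_is_derive_coframe j q v).
move=> /(_ s t) [_]; under eq_fun do rewrite -left_metricE.
move->; rewrite mxE mulrDr; congr (_ + _).
  rewrite -adE -!colE /dcoframe /dot mxE mulr_sumr; apply: eq_bigr => k _.
  by move: (ad j v) (coframe j q) => B A; rewrite !mxE; ring.
rewrite -adE -!colE /dcoframe /dot mxE mulr_sumr; apply: eq_bigr => k _.
by move: (ad j v) (coframe j q) => B A; rewrite !mxE; ring.
Qed.

(** Both sides reduce to values of [dot (bracket x y) z] on the images under
    [coframe q] of the coordinate vectors, where Koszul's formula applies: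
    by [bracket_coframe] these images have the same brackets. *)
Lemma lower_christoffel (l a b : 'I_(m + r)) q :
  (left_metric j q *m gauge_christoffel (delta_mx a 0) q) l b =
  2^-1 * (pderiv (fun q => left_metric j q b l) a q
    + pderiv (fun q => left_metric j q a l) b q
    - pderiv (fun q => left_metric j q a b) l q).
Proof.
rewrite !pderiv_left_metric.
set x := delta_mx a 0; set y := delta_mx b 0; set z := delta_mx l 0.
have -> : (left_metric j q *m gauge_christoffel x q) l b =
    dot (conn j (coframe j q *m x) *m (coframe j q *m y)) (coframe j q *m z)
    - 2^-1 * dot (bracket j x y) (coframe j q *m z).
  rewrite left_metricE /gauge_christoffel mulmxDr !mulmxA -[_ *m frame j q]mulmxA.
  rewrite mul_coframe_frame mulmx1 -[_ *m coframe j q *m dcoframe j x]mulmxA.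
  rewrite mul_coframe_dcoframe -adE -!colE /dcoframe mxE; congr (_ + _).
    rewrite -mulmxA; move: (conn j (col a _) *m coframe j q) => M.
    move: (coframe j q) => A.
    by rewrite mxE /dot; apply: eq_bigr => k _; rewrite !mxE mulrC.
  move: (ad j x) (coframe j q) => B A.
  rewrite mxE /dot mulr_sumr -sumrN; apply: eq_bigr => k _.
  by rewrite !mxE; ring.
rewrite koszul // !bracket_coframe.
rewrite (bracketC jso z x) (bracketC jso z y) (bracketC jso y x).
by rewrite !dotNl; field.
Qed.

Lemma christoffelE (k a b : 'I_(m + r)) q :
  christoffel (left_metric j) k a b q = gauge_christoffel (delta_mx a 0) q k b.
Proof.
have gu : left_metric j q \in unitmx.
  by rewrite left_metricE unitmx_mul unitmx_tr (proj1 (mulmx1_unit (mul_coframe_frame j q))).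
rewrite -[RHS](congr1 (fun M : 'M_(_, _) => M k b) (mulKmx gu _)).
rewrite mxE /christoffel mulr_sumr; apply: eq_bigr => l _.
by rewrite lower_christoffel; ring.
Qed.

(** The curvature operator R(x, y) of the left invariant metric on the Lie
    algebra. *)
Definition alg_curv (x y : 'cV[R]_(m + r)) : 'M[R]_(m + r) :=
  conn j x *m conn j y - conn j y *m conn j x - conn j (bracket j x y).

Lemma mx_is_derive_gauge_christoffel u v p :
  mx_is_derive p v (gauge_christoffel u)
    (- dcoframe j v *m conn j (coframe j p *m u) *m coframe j p
     + frame j p *m conn j (dcoframe j v *m u) *m coframe j p
     + frame j p *m conn j (coframe j p *m u) *m dcoframe j v).
Proof.
rewrite -[X in mx_is_derive _ _ _ X]addr0.
apply: mx_is_deriveD; last first.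
  by apply: mx_is_derive_affine => h; rewrite scaler0 add0r.
rewrite -mulmxDl.
apply: mx_is_deriveM; last exact: mx_is_derive_coframe.
apply: mx_is_deriveM; first exact: mx_is_derive_frame.
apply: mx_is_derive_affine => h; rewrite coframe_affine.
by rewrite mulmxDl -scalemxAl linearP.
Qed.

Lemma riem_coefE (k a b c : 'I_(m + r)) p :
  riem_coef (left_metric j) k a b c p =
  (frame j p *m alg_curv (coframe j p *m delta_mx a 0) (coframe j p *m delta_mx b 0)
    *m coframe j p) k c.
Proof.
rewrite /riem_coef.
have dE (s t : 'I_(m + r)) :
  pderiv (christoffel (left_metric j) k t c) s p =
    (- dcoframe j (delta_mx s 0) *m conn j (coframe j p *m delta_mx t 0) *m coframe j p
     + frame j p *m conn j (dcoframe j (delta_mx s 0) *m delta_mx t 0) *m coframe j p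
     + frame j p *m conn j (coframe j p *m delta_mx t 0) *m dcoframe j (delta_mx s 0)) k c.
  have [_ <-] := mx_is_derive_gauge_christoffel (delta_mx t 0) (delta_mx s 0) p k c.
  have cE : christoffel (left_metric j) k t c =
      fun q => gauge_christoffel (delta_mx t 0) q k c.
    by apply/funext => q; rewrite christoffelE.
  by rewrite /pderiv cE.
rewrite !dE.
under eq_bigr do rewrite !christoffelE.
rewrite sumrB.
set x := delta_mx a 0; set y := delta_mx b 0.
rewrite /alg_curv bracket_coframe.
(* The Maurer-Cartan equation for the coframe; it yields the third term of
   [alg_curv]. *)
have Dxy : - bracket j x y = dcoframe j x *m y - dcoframe j y *m x.
  rewrite /dcoframe !mulNmx -!scalemxAl !adE (bracketC jso y x) scalerN !opprK.
  rewrite -opprD -scalerDl; congr (- _).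
  by rewrite -[LHS]scale1r; congr (_ *: _); field.
have -> : - conn j (bracket j x y) =
    conn j (dcoframe j x *m y) - conn j (dcoframe j y *m x).
  by rewrite -(raddfB (conn j)) -Dxy raddfN.
have mulE (M N : 'M[R]_(m + r)) : \sum_(s < m + r) M k s * N s c = (M *m N) k c.
  by rewrite mxE.
rewrite !mulE /gauge_christoffel.
set X := conn j (coframe j p *m x); set Y := conn j (coframe j p *m y).
have combE (M1 M2 M3 M4 : 'M[R]_(m + r)) :
    M1 k c - M2 k c + (M3 k c - M4 k c) = (M1 - M2 + (M3 - M4)) k c.
  by rewrite !mxE.
rewrite combE (curvature_gauge_change (D := dcoframe j x) (E := dcoframe j y)) //.
- exact: mul_coframe_frame.
- exact: mul_coframe_dcoframe.
- exact: mul_coframe_dcoframe.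
- exact: mul_dcoframe_frame.
- exact: mul_dcoframe_frame.
- exact: mul_dcoframe_dcoframe.
- exact: mul_dcoframe_dcoframe.
Qed.

End Curvature.

Section Invariants.
Variables (R : realType) (m r : nat) (j : {linear 'cV[R]_r -> 'M[R]_m}).
Hypothesis jso : forall z, (j z)^T = - j z.

Lemma alg_curv_linearl y : linear (alg_curv j ^~ y).
Proof.
move=> h u v; rewrite /alg_curv bracketDl bracketZl !(conn_is_linear j).
move: (conn j u) (conn j v) (conn j y) (conn j (bracket j u y))
  (conn j (bracket j v y)) => U V Y B B'.
rewrite mulmxDl mulmxDr -(scalemxAl h) -(scalemxAr h) !scalerBr !opprD !addrA.
by rewrite [LHS](ACl (1*3*5*2*4*6))/=.
Qed.

Lemma alg_curv_linearr x : linear (alg_curv j x).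
Proof.
move=> h u v; rewrite /alg_curv bracket_is_linear !(conn_is_linear j).
move: (conn j u) (conn j v) (conn j x) (conn j (bracket j x u))
  (conn j (bracket j x v)) => U V X B B'.
rewrite mulmxDl mulmxDr -(scalemxAl h) -(scalemxAr h) !scalerBr !opprD !addrA.
by rewrite [LHS](ACl (1*3*5*2*4*6))/=.
Qed.

Lemma curv_opE p u v w :
  curv_op (left_metric j) p u v w =
  frame j p *m (alg_curv j (coframe j p *m u) (coframe j p *m v) *m (coframe j p *m w)).
Proof.
apply/colP => k.
rewrite (trilinear_expand _ _ _ _ _ _ alg_curv_linearl alg_curv_linearr) mxE.
apply: eq_bigr => a _; apply: eq_bigr => b _; apply: eq_bigr => c _.
by rewrite riem_coefE.
Qed.

Definition alg_ric (v w : 'cV[R]_(m + r)) : R :=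
  \sum_(a < m + r) (alg_curv j (delta_mx a 0) v *m w) a 0.

Lemma alg_ric_linearl w : linear (alg_ric^~ w : _ -> R^o).
Proof.
move=> h u v; rewrite /alg_ric scaler_sumr -big_split; apply: eq_bigr => a _.
by rewrite alg_curv_linearr mulmxZDl [LHS]mxE [X in X + _]mxE.
Qed.

Lemma alg_ric_linearr v : linear (alg_ric v : _ -> R^o).
Proof.
move=> h u w; rewrite /alg_ric scaler_sumr -big_split; apply: eq_bigr => a _.
by rewrite mulmxZDr [LHS]mxE [X in X + _]mxE.
Qed.

Lemma ricE p v w :
  ric (left_metric j) p v w = alg_ric (coframe j p *m v) (coframe j p *m w).
Proof.
rewrite /ric; under eq_bigr do rewrite curv_opE.
apply: (@trace_similar _ _ (coframe j p) (frame j p)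
  (fun x => alg_curv j x (coframe j p *m v) *m (coframe j p *m w))).
  by move=> h x y; rewrite alg_curv_linearl mulmxZDl.
exact: mul_coframe_frame.
Qed.

Lemma scalE p :
  scal (left_metric j) p = \sum_(a < m + r) alg_ric (delta_mx a 0) (delta_mx a 0).
Proof.
pose b v w : R^o := alg_ric (coframe j p *m v) (coframe j p *m w).
have bl w : linear (b^~ w).
  by move=> h x y; rewrite /b mulmxZDr alg_ric_linearl.
have br v : linear (b v).
  by move=> h x y; rewrite /b mulmxZDr alg_ric_linearr.
(* The columns of [frame p] form an orthonormal frame for the metric. *)
transitivity (\sum_(a < m + r) b (frame j p *m delta_mx a 0) (frame j p *m delta_mx a 0)).
  rewrite (sum_quadratic _ bl br).
  apply: eq_bigr => i _; apply: eq_bigr => k _.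
  rewrite invmx_left_metric ricE -/(b _ _) mxE; congr (_ * _).
  by apply: eq_bigr => a _; rewrite -colE !mxE.
by apply: eq_bigr => a _; rewrite /b !mulmxA mul_coframe_frame mul1mx.
Qed.

Lemma innerE p u v :
  inner (left_metric j) p u v = dot (coframe j p *m u) (coframe j p *m v).
Proof. by rewrite inner_left_metric !dgmul_inv_coframe. Qed.

Lemma riemE p u v w z :
  riem (left_metric j) p u v w z =
  dot (alg_curv j (coframe j p *m u) (coframe j p *m v) *m (coframe j p *m w))
      (coframe j p *m z).
Proof. by rewrite /riem innerE curv_opE mulmxA mul_coframe_frame mul1mx. Qed.

Section Norms.
Variables (p : 'cV[R]_(m + r)) (e : 'I_(m + r) -> 'cV[R]_(m + r)).
Hypothesis eon : orthonormal_basis (inner (left_metric j) p) e.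

Lemma coframe_onb : orthonormal_basis (@dot R _) (fun a => coframe j p *m e a).
Proof. by move=> a b; rewrite -innerE eon. Qed.

Lemma ric_normsqE :
  ric_normsq (left_metric j) p e =
  \sum_(a < m + r) \sum_(b < m + r) alg_ric (delta_mx a 0) (delta_mx b 0) ^+ 2.
Proof.
rewrite -(sum_sqr_onb2 alg_ric_linearl alg_ric_linearr coframe_onb).
by apply: eq_bigr => a _; apply: eq_bigr => b _; rewrite ricE.
Qed.

Lemma riem_normsqE :
  riem_normsq (left_metric j) p e =
  \sum_(a < m + r) \sum_(b < m + r) \sum_(c < m + r) \sum_(d < m + r)
    alg_curv j (delta_mx a 0) (delta_mx b 0) c d ^+ 2.
Proof.
pose T x y z w : R^o := dot (alg_curv j x y *m z) w.
have T1 y z w : linear (fun x => T x y z w).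
  by move=> h u v; rewrite /T alg_curv_linearl mulmxZDl dotDl dotZl.
have T2 x z w : linear (fun y => T x y z w).
  by move=> h u v; rewrite /T alg_curv_linearr mulmxZDl dotDl dotZl.
have T3 x y w : linear (fun z => T x y z w).
  by move=> h u v; rewrite /T mulmxZDr dotDl dotZl.
have T4 x y z : linear (T x y z).
  by move=> h u v; rewrite /T dotC dotDl dotZl !(dotC _ (_ *m _)).
(* Pass to the standard basis in the last two arguments, then exchange the
   sums to do so in the first two. *)
have on := coframe_onb; rewrite /riem_normsq.
under eq_bigr => a _ do under eq_bigr => b _ do
  (under eq_bigr => c _ do (under eq_bigr => d _ do rewrite riemE -/(T _ _ _ _));
   rewrite (sum_sqr_onb2 (T3 _ _) (T4 _ _) on)).
rewrite exchange_sum4.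
under eq_bigr => c _ do under eq_bigr => d _ do
  rewrite (sum_sqr_onb2 (fun y => T1 y _ _) (fun x => T2 x _ _) on).
rewrite exchange_sum4.
apply: eq_bigr => a _; apply: eq_bigr => b _; rewrite exchange_big.
apply: eq_bigr => d _; apply: eq_bigr => c _; congr (_ ^+ 2).
rewrite /T -colE /dot (bigD1 d) //= big1 => [|s /negPf sd].
  by rewrite !mxE !eqxx mulr1 addr0.
by rewrite [delta_mx _ _ _ _]mxE sd mulr0.
Qed.
End Norms.
End Invariants.

(** * Quartic sums over a family of skew matrices *)

Section Sum4.
Variables (R : nmodType) (n : nat).
Implicit Type F : 'I_n -> 'I_n -> 'I_n -> 'I_n -> R.

Definition sum4 F : R :=
  \sum_(a < n) \sum_(b < n) \sum_(c < n) \sum_(d < n) F a b c d.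

Lemma eq_sum4 F G : (forall a b c d, F a b c d = G a b c d) -> sum4 F = sum4 G.
Proof.
move=> FG; apply: eq_bigr => a _; apply: eq_bigr => b _; apply: eq_bigr => c _.
exact: eq_bigr.
Qed.

Lemma sum4_swap12 F : sum4 F = sum4 (fun a b c d => F b a c d).
Proof. exact: exchange_big. Qed.

Lemma sum4_swap23 F : sum4 F = sum4 (fun a b c d => F a c b d).
Proof. by apply: eq_bigr => a _; exact: exchange_big. Qed.

Lemma sum4_swap34 F : sum4 F = sum4 (fun a b c d => F a b d c).
Proof. by apply: eq_bigr => a _; apply: eq_bigr => b _; exact: exchange_big. Qed.

Lemma sum4D F G : sum4 (fun a b c d => F a b c d + G a b c d) = sum4 F + sum4 G.
Proof.
rewrite /sum4 -big_split; apply: eq_bigr => a _; rewrite -big_split.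
apply: eq_bigr => b _; rewrite -big_split; apply: eq_bigr => c _.
by rewrite -big_split.
Qed.

Lemma sum4_cbda F : sum4 (fun a b c d => F c b d a) = sum4 F.
Proof. by rewrite sum4_swap23 sum4_swap12 sum4_swap23 sum4_swap34. Qed.

Lemma sum4_cadb F : sum4 (fun a b c d => F c a d b) = sum4 F.
Proof. by rewrite sum4_swap23 sum4_swap12 sum4_swap34. Qed.

Lemma sum4_cbad F : sum4 (fun a b c d => F c b a d) = sum4 F.
Proof. by rewrite sum4_swap23 sum4_swap12 sum4_swap23. Qed.

Lemma sum4_cabd F : sum4 (fun a b c d => F c a b d) = sum4 F.
Proof. by rewrite sum4_swap23 sum4_swap12. Qed.
End Sum4.

Section SkewFamily.
Variables (R : realType) (m r : nat) (k : 'I_r -> 'M[R]_m).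
Hypothesis ksk : forall s, (k s)^T = - k s.

Lemma sum4Z (x : R) F : sum4 (fun a b c d : 'I_m => x * F a b c d) = x * sum4 F.
Proof.
rewrite /sum4 mulr_sumr; apply: eq_bigr => a _; rewrite mulr_sumr.
apply: eq_bigr => b _; rewrite mulr_sumr; apply: eq_bigr => c _.
by rewrite mulr_sumr.
Qed.

Lemma skewE s a b : k s b a = - k s a b.
Proof. by have := congr1 (fun M : 'M_m => M a b) (ksk s); rewrite !mxE. Qed.

Lemma skew_diag s a : k s a a = 0.
Proof. by have := skewE s a a => kaa; lra. Qed.

(** The quadratic curvature terms on v depend on the [k s] only through this
    tensor, skew in its first and in its last two indices. *)
Definition pairing a b c d : R := \sum_(s < r) k s a b * k s c d.

Lemma pairingNl a b c d : pairing b a c d = - pairing a b c d.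
Proof. by rewrite -sumrN; apply: eq_bigr => s _; rewrite skewE mulNr. Qed.

Lemma pairingNr a b c d : pairing a b d c = - pairing a b c d.
Proof. by rewrite -sumrN; apply: eq_bigr => s _; rewrite [k s d c]skewE mulrN. Qed.

Lemma pairingC a b c d : pairing a b c d = pairing c d a b.
Proof. by apply: eq_bigr => s _; rewrite mulrC. Qed.

Lemma mxtrace_mul_skew s t :
  \tr (k s *m k t) = - \sum_(a < m) \sum_(b < m) k s a b * k t a b.
Proof.
rewrite -sumrN; apply: eq_bigr => a _; rewrite mxE -sumrN.
by apply: eq_bigr => b _; rewrite (skewE _ a b) mulrN.
Qed.

Lemma sum4_exchange (F : 'I_r -> 'I_r -> 'I_m -> 'I_m -> 'I_m -> 'I_m -> R) :
  sum4 (fun a b c d => \sum_(s < r) \sum_(t < r) F s t a b c d) =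
  \sum_(s < r) \sum_(t < r) sum4 (F s t).
Proof.
rewrite /sum4.
do 4 (under [RHS]eq_bigr do rewrite exchange_big; rewrite [RHS]exchange_big;
  apply: eq_bigr => ? _).
by [].
Qed.

Lemma sum_pairing_sqr :
  sum4 (fun a b c d => pairing a b c d ^+ 2) =
  \sum_(s < r) \sum_(t < r) \tr (k s *m k t) ^+ 2.
Proof.
under eq_sum4 => a b c d do rewrite expr2 /pairing big_distrlr /=.
rewrite sum4_exchange; apply: eq_bigr => s _; apply: eq_bigr => t _.
rewrite mxtrace_mul_skew sqrrN expr2 mulr_suml /sum4.
apply: eq_bigr => a _; rewrite mulr_suml; apply: eq_bigr => b _.
rewrite mulr_sumr; apply: eq_bigr => c _; rewrite mulr_sumr.
by apply: eq_bigr => d _; ring.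
Qed.

(** The indices of the two factors form a 4-cycle along which [k s] and [k t]
    alternate, hence the trace. *)
Lemma sum_pairing_cycle :
  sum4 (fun a b c d => pairing a b c d * pairing b c d a) =
  \sum_(s < r) \sum_(t < r) \tr (k s *m k t *m k s *m k t).
Proof.
under eq_sum4 => a b c d do rewrite /pairing big_distrlr /=.
rewrite sum4_exchange; apply: eq_bigr => s _; apply: eq_bigr => t _.
transitivity (\sum_(a < m) \sum_(d < m) \sum_(c < m) \sum_(b < m)
   k s a b * k s c d * (k t b c * k t d a)).
  apply: eq_bigr => a _; rewrite exchange_big /=.
  under eq_bigr do rewrite exchange_big; rewrite exchange_big /=.
  by [].
apply: eq_bigr => a _; rewrite mxE; apply: eq_bigr => d _.
rewrite mxE mulr_suml; apply: eq_bigr => c _; rewrite mxE !mulr_suml.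
by apply: eq_bigr => b _; ring.
Qed.

(** Each square contributes a sum of squares of [pairing]. Each of the three
    cross terms, reoriented by skew-symmetry, is a 4-cycle as in
    [sum_pairing_cycle]: their coefficients -1/8, 1/4, 1/4 add up to 3/8. *)
Lemma sum_quartic :
  sum4 (fun a b c d => (4^-1 * (pairing c b d a - pairing c a d b)
    + 2^-1 * pairing b a c d) ^+ 2) =
  3 / 8 * sum4 (fun a b c d => pairing a b c d ^+ 2)
  + 3 / 8 * sum4 (fun a b c d => pairing a b c d * pairing b c d a).
Proof.
pose G a b c d := pairing a b c d ^+ 2.
pose H a b c d := pairing a b c d * pairing b c d a.
transitivity (sum4 (fun a b c d => 16^-1 * G c b d a + 16^-1 * G c a d b
    + 4^-1 * G b a c d + - 8^-1 * H c b d a + 4^-1 * H c b a d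
    + 4^-1 * H c a b d)).
  apply: eq_sum4 => a b c d; rewrite /G /H.
  rewrite (pairingC b d a c) (pairingNl c a) (pairingNr c a d b) opprK.
  rewrite (pairingNr c b d a) (pairingNl b a d c) (pairingNr b a c d).
  by field.
rewrite !sum4D !sum4Z.
rewrite (sum4_cbda G) (sum4_cadb G) -(sum4_swap12 G).
rewrite (sum4_cbda H) (sum4_cbad H) (sum4_cabd H).
by field.
Qed.

Definition normsq p q (M : 'M[R]_(p, q)) : R := \sum_(c < p) \sum_(d < q) M c d ^+ 2.

Lemma normsqE p q (M : 'M[R]_(p, q)) : normsq M = \tr (M *m M^T).
Proof.
apply: eq_bigr => c _; rewrite mxE; apply: eq_bigr => d _.
by rewrite mxE expr2.
Qed.

Lemma normsqZ p q x (M : 'M[R]_(p, q)) : normsq (x *: M) = x ^+ 2 * normsq M.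
Proof.
rewrite /normsq mulr_sumr; apply: eq_bigr => c _; rewrite mulr_sumr.
by apply: eq_bigr => d _; rewrite mxE exprMn.
Qed.

Lemma normsqN p q (M : 'M[R]_(p, q)) : normsq (- M) = normsq M.
Proof. by rewrite -scaleN1r normsqZ sqrrN expr1n mul1r. Qed.

Lemma normsq0 p q : normsq (0 : 'M[R]_(p, q)) = 0.
Proof. by rewrite normsqE mul0mx mxtrace0. Qed.

Lemma normsq_block p1 p2 q1 q2 (A : 'M[R]_(p1, q1)) (B : 'M[R]_(p1, q2))
    (C : 'M[R]_(p2, q1)) (D : 'M[R]_(p2, q2)) :
  normsq (block_mx A B C D) = normsq A + normsq B + normsq C + normsq D.
Proof.
rewrite /normsq big_split_ord -[RHS]addrA; congr (_ + _); rewrite -big_split;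
  apply: eq_bigr => c _; rewrite big_split_ord; congr (_ + _);
  apply: eq_bigr => d _.
- by rewrite block_mxEul.
- by rewrite block_mxEur.
- by rewrite block_mxEdl.
- by rewrite block_mxEdr.
Qed.

Lemma tr_mul_skew s t : (k s *m k t)^T = k t *m k s.
Proof. by rewrite trmx_mul !ksk mulmxN mulNmx opprK. Qed.

Lemma normsq_mul_skew s t :
  normsq (k s *m k t) = \tr (k s *m k s *m (k t *m k t)).
Proof.
by rewrite normsqE tr_mul_skew mulmxA mxtrace_mulC !mulmxA.
Qed.

Lemma normsq_commutator s t :
  normsq (k s *m k t - k t *m k s) =
  normsq (k s *m k t) + normsq (k t *m k s) - 2 * \tr (k s *m k t *m k s *m k t).
Proof.
rewrite !normsqE [(_ - _)^T]linearB /= !tr_mul_skew.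
rewrite mulmxBl !mulmxBr !linearB /= !mulmxA.
have -> : \tr (k t *m k s *m k t *m k s) = \tr (k s *m k t *m k s *m k t).
  by rewrite mxtrace_mulC !mulmxA.
ring.
Qed.

Lemma sum_normsq_commutator :
  \sum_(s < r) \sum_(t < r) normsq (k s *m k t - k t *m k s) =
  2 * (\sum_(s < r) \sum_(t < r) \tr (k s *m k s *m (k t *m k t)))
  - 2 * \sum_(s < r) \sum_(t < r) \tr (k s *m k t *m k s *m k t).
Proof.
under eq_bigr => s _.
  under eq_bigr => t _ do rewrite normsq_commutator.
  rewrite sumrB big_split /= -mulr_sumr.
  over.
rewrite sumrB big_split /= -mulr_sumr; congr (_ - _).
rewrite [X in _ + X]exchange_big /= mulr2n mulrDl !mul1r.
by congr (_ + _); apply: eq_bigr => s _; apply: eq_bigr => t _;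
  rewrite normsq_mul_skew.
Qed.

End SkewFamily.

(** * Components of the curvature along v and z *)

Section Components.
Variables (R : realType) (m r : nat) (j : {linear 'cV[R]_r -> 'M[R]_m}).
Hypothesis jso : forall z, (j z)^T = - j z.

Local Notation k s := (j (delta_mx s 0)).
Local Notation vdir a := (delta_mx (lshift r a) 0 : 'cV[R]_(m + r)).
Local Notation zdir s := (delta_mx (rshift m s) 0 : 'cV[R]_(m + r)).
Local Notation P a := (half_ad j (vdir a)).
Let kfam (s : 'I_r) : 'M[R]_m := k s.
Let ksk s : (kfam s)^T = - kfam s := jso _.

Lemma usub_vdir a : usubmx (vdir a) = delta_mx a 0.
Proof. by apply/colP => b; rewrite !mxE (inj_eq (@lshift_inj _ _)). Qed.
Lemma dsub_vdir a : dsubmx (vdir a) = 0.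
Proof. by apply/colP => b; rewrite !mxE eq_rlshift. Qed.
Lemma usub_zdir s : usubmx (zdir s) = 0.
Proof. by apply/colP => b; rewrite !mxE eq_lrshift. Qed.
Lemma dsub_zdir s : dsubmx (zdir s) = delta_mx s 0.
Proof. by apply/colP => b; rewrite !mxE (inj_eq (@rshift_inj _ _)). Qed.

Lemma half_ad_vdir a s b : P a s b = k s b a.
Proof. by rewrite mxE usub_vdir -colE mxE. Qed.

Lemma half_ad_usub0 u : usubmx u = 0 -> half_ad j u = 0.
Proof. by move=> u0; apply/matrixP => s b; rewrite mxE u0 mulmx0 !mxE. Qed.

Lemma bracket_usub0 u v : usubmx v = 0 -> bracket j u v = 0.
Proof.
move=> v0; rewrite -[bracket j u v]vsubmxK -mul_half_ad v0 mulmx0.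
by rewrite usub_bracket col_mx0.
Qed.

Lemma conn_vdir a : conn j (vdir a) = 2^-1 *: block_mx 0 (- (P a)^T) (P a) 0.
Proof. by rewrite /conn dsub_vdir linear0 oppr0. Qed.

Lemma conn_zdir s : conn j (zdir s) = 2^-1 *: block_mx (- k s) 0 0 0.
Proof. by rewrite /conn dsub_zdir half_ad_usub0 ?usub_zdir // trmx0 oppr0. Qed.

Lemma conn_bracket_vdir a b :
  conn j (bracket j (vdir a) (vdir b)) =
  2^-1 *: block_mx (- \sum_(s < r) P a s b *: k s) 0 0 0.
Proof.
rewrite /conn (half_ad_usub0 (usub_bracket _ _ _)) trmx0 oppr0.
rewrite -mul_half_ad usub_vdir -colE.
have lj : linear j by move=> h x y; rewrite linearP.
rewrite (linear_expand lj); congr (_ *: block_mx (- _) _ _ _).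
by apply: eq_bigr => s _; rewrite mxE.
Qed.

(** The matrix [conn] of a vector of v exchanges v and z and
    [conn] of a vector of z preserves them: hence the shapes of the blocks. *)
Lemma alg_curv_vv a b :
  alg_curv j (vdir a) (vdir b) =
  block_mx (4^-1 *: ((P b)^T *m P a - (P a)^T *m P b)
            + 2^-1 *: \sum_(s < r) P a s b *: k s) 0
    0 (4^-1 *: (P b *m (P a)^T - P a *m (P b)^T)).
Proof.
rewrite /alg_curv conn_bracket_vdir !conn_vdir.
move: (P a) (P b) (\sum_(s < r) _) => A B C.
rewrite -!scalemxAl -!scalemxAr !mulmx_block !mul0mx !mulmx0 !add0r !addr0.
have -> : 4^-1 = 2^-1 * 2^-1 :> R by rewrite -invfM -natrM.
rewrite !mulNmx !mulmxN !scale_block_mx !scaler0.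
rewrite !opp_block_mx !add_block_mx !oppr0 !addr0 !scalerN !opprK -!scalerA.
by rewrite ![- (2^-1 *: _) + _]addrC -!scalerBr.
Qed.

Lemma alg_curv_vz a s :
  alg_curv j (vdir a) (zdir s) =
  block_mx 0 (- 4^-1 *: (k s *m (P a)^T)) (- 4^-1 *: (P a *m k s)) 0.
Proof.
rewrite /alg_curv bracket_usub0 ?usub_zdir // linear0 subr0 conn_vdir conn_zdir.
move: (P a) (k s) => A B.
rewrite -!scalemxAl -!scalemxAr !mulmx_block !mul0mx !mulmx0 !add0r !addr0.
have -> : 4^-1 = 2^-1 * 2^-1 :> R by rewrite -invfM -natrM.
rewrite !mulNmx !mulmxN !scale_block_mx !scaler0.
rewrite !opp_block_mx !add_block_mx !oppr0 !addr0 !add0r.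
by rewrite !opprK !scalerN !scaleNr !scalerA.
Qed.

Lemma alg_curv_zz s t :
  alg_curv j (zdir s) (zdir t) =
  block_mx (4^-1 *: (k s *m k t - k t *m k s)) 0 0 0.
Proof.
rewrite /alg_curv bracket_usub0 ?usub_zdir // linear0 subr0 !conn_zdir.
move: (k s) (k t) => A B.
rewrite -!scalemxAl -!scalemxAr !mulmx_block !mul0mx !mulmx0 !addr0.
have -> : 4^-1 = 2^-1 * 2^-1 :> R by rewrite -invfM -natrM.
rewrite !mulNmx !mulmxN !opprK !scale_block_mx !scaler0.
by rewrite !opp_block_mx !add_block_mx !oppr0 !addr0 -!scalerA -!scalerBr.
Qed.

Lemma alg_curvC x y : alg_curv j y x = - alg_curv j x y.
Proof.
rewrite /alg_curv (bracketC jso y x) (raddfN (conn j)).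
by rewrite opprD opprB.
Qed.

Lemma vv_block_entry a b c d :
  (4^-1 *: ((P b)^T *m P a - (P a)^T *m P b)
    + 2^-1 *: \sum_(s < r) P a s b *: k s) c d =
  4^-1 * (pairing kfam c b d a - pairing kfam c a d b)
  + 2^-1 * pairing kfam b a c d.
Proof.
rewrite mxE [X in X + _]mxE [X in _ + X]mxE; congr (_ * _ + _ * _).
  rewrite mxE [X in _ + X]mxE; congr (_ - _); rewrite mxE;
    by apply: eq_bigr => s _; rewrite mxE !half_ad_vdir.
by rewrite summxE; apply: eq_bigr => s _; rewrite mxE half_ad_vdir.
Qed.

Lemma normsq_vv :
  \sum_(a < m) \sum_(b < m) normsq (alg_curv j (vdir a) (vdir b)) =
  3 / 8 * (\sum_(s < r) \sum_(t < r) \tr (k s *m k t) ^+ 2)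
  + 3 / 8 * (\sum_(s < r) \sum_(t < r) \tr (k s *m k t *m k s *m k t))
  + 16^-1 * (\sum_(s < r) \sum_(t < r) normsq (k s *m k t - k t *m k s)).
Proof.
under eq_bigr => a _.
  under eq_bigr => b _ do rewrite alg_curv_vv normsq_block !normsq0 !addr0.
  rewrite big_split /=.
  over.
rewrite big_split /=; congr (_ + _).
  rewrite -(sum_pairing_sqr ksk) -(sum_pairing_cycle kfam) -(sum_quartic ksk).
  apply: eq_bigr => a _; apply: eq_bigr => b _; apply: eq_bigr => c _.
  apply: eq_bigr => d _; congr (_ ^+ 2).
  exact: vv_block_entry.
rewrite /normsq exchange_sum4 mulr_sumr; apply: eq_bigr => s _.
rewrite mulr_sumr; apply: eq_bigr => t _; rewrite mulr_sumr.
apply: eq_bigr => a _; rewrite mulr_sumr; apply: eq_bigr => b _.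
(* The z-block consists of the entries of the commutators of the [k s]; this
   is the pair symmetry of the curvature. *)
have PP c d : (P c *m (P d)^T) s t = - (k s *m k t) c d.
  rewrite !mxE -sumrN; apply: eq_bigr => e _.
  by rewrite [(_)^T _ _]mxE !half_ad_vdir (skewE ksk s c e) mulNr.
rewrite mxE exprMn; congr (_ * _); first by rewrite expr2 -invfM -natrM.
have subE p q (M N : 'M[R]_(p, q)) c d : (M - N) c d = M c d - N c d.
  by rewrite !mxE.
have kC : (k t *m k s) a b = (k s *m k t) b a.
  by rewrite -[LHS](congr1 (fun M : 'M_m => M a b) (tr_mul_skew ksk s t)) mxE.
by rewrite !subE !PP kC; ring.
Qed.

Lemma normsq_vz :
  \sum_(a < m) \sum_(s < r) normsq (alg_curv j (vdir a) (zdir s)) =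
  8^-1 * \sum_(s < r) \sum_(t < r) \tr (k s *m k s *m (k t *m k t)).
Proof.
have Q1 : \sum_(a < m) \sum_(s < r) normsq (k s *m (P a)^T) =
    \sum_(s < r) \sum_(t < r) normsq (k s *m k t).
  rewrite exchange_big; apply: eq_bigr => s _; rewrite /normsq.
  rewrite [RHS]exchange_big /=.
  transitivity (\sum_(a < m) \sum_(c < m) \sum_(t < r) (k s *m k t) c a ^+ 2).
    apply: eq_bigr => a _; apply: eq_bigr => c _; apply: eq_bigr => t _.
    rewrite !mxE; congr (_ ^+ 2); apply: eq_bigr => d _.
    by rewrite [(_)^T _ _]mxE half_ad_vdir.
  rewrite exchange_big; apply: eq_bigr => c _.
  by rewrite exchange_big.
have Q2 : \sum_(a < m) \sum_(s < r) normsq (P a *m k s) =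
    \sum_(s < r) \sum_(t < r) normsq (k s *m k t).
  transitivity (\sum_(a < m) \sum_(s < r) \sum_(t < r) \sum_(c < m) (k t *m k s) a c ^+ 2).
    apply: eq_bigr => a _; apply: eq_bigr => s _; apply: eq_bigr => t _.
    apply: eq_bigr => c _.
    rewrite !mxE -sqrrN -sumrN; congr (_ ^+ 2); apply: eq_bigr => d _.
    by rewrite half_ad_vdir (skewE ksk t a d) mulNr opprK.
  rewrite exchange_big [RHS]exchange_big; apply: eq_bigr => s _.
  by rewrite exchange_big.
under eq_bigr => a _.
  under eq_bigr => s _.
    rewrite alg_curv_vz normsq_block !normsq0 addr0 add0r !normsqZ sqrrN -mulrDr.
    over.
  rewrite -mulr_sumr big_split.
  over.
rewrite -mulr_sumr big_split /= Q1 Q2.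
have -> : \sum_(s < r) \sum_(t < r) normsq (k s *m k t) =
    \sum_(s < r) \sum_(t < r) \tr (k s *m k s *m (k t *m k t)).
  by apply: eq_bigr => s _; apply: eq_bigr => t _; exact: (normsq_mul_skew ksk).
by field.
Qed.

Lemma normsq_zz :
  \sum_(s < r) \sum_(t < r) normsq (alg_curv j (zdir s) (zdir t)) =
  16^-1 * \sum_(s < r) \sum_(t < r) normsq (k s *m k t - k t *m k s).
Proof.
rewrite mulr_sumr; apply: eq_bigr => s _; rewrite mulr_sumr; apply: eq_bigr => t _.
rewrite alg_curv_zz normsq_block !normsq0 !addr0 normsqZ.
by rewrite expr2 -invfM -natrM.
Qed.

(** The z-block of K(v,v) and K(z,z) together give [(1/8) \sum |[k s, k t]|^2],
    that is [(1/4) (Tr J^2 - I_abab)]; K(v,z) and K(z,v) give another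
    [(1/4) Tr J^2]. *)
Lemma riem_normsq_std :
  \sum_(x < m + r) \sum_(y < m + r) normsq (alg_curv j (delta_mx x 0) (delta_mx y 0)) =
  1 / 2 * (\sum_(s < r) \sum_(t < r) \tr (k s *m k s *m (k t *m k t)))
  + 3 / 8 * (\sum_(s < r) \sum_(t < r) \tr (k s *m k t) ^+ 2)
  + 1 / 8 * \sum_(s < r) \sum_(t < r) \tr (k s *m k t *m k s *m k t).
Proof.
have zv : \sum_(s < r) \sum_(a < m) normsq (alg_curv j (zdir s) (vdir a)) =
    \sum_(a < m) \sum_(s < r) normsq (alg_curv j (vdir a) (zdir s)).
  rewrite exchange_big; apply: eq_bigr => a _; apply: eq_bigr => s _.
  by rewrite alg_curvC normsqN.
rewrite big_split_ord /=.
under eq_bigr do rewrite big_split_ord.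
under [X in _ + X]eq_bigr do rewrite big_split_ord.
rewrite !big_split /= zv normsq_vv normsq_vz normsq_zz.
have -> := sum_normsq_commutator ksk.
by rewrite /kfam; field.
Qed.

Let J : 'M[R]_m := \sum_(s < r) k s *m k s.

Lemma alg_ric_entry x y :
  alg_ric j (delta_mx x 0) (delta_mx y 0) =
  \sum_(a < m) alg_curv j (vdir a) (delta_mx x 0) (lshift r a) y
  + \sum_(s < r) alg_curv j (zdir s) (delta_mx x 0) (rshift m s) y.
Proof.
rewrite /alg_ric big_split_ord.
by congr (_ + _); apply: eq_bigr => a _; rewrite -colE mxE.
Qed.

Lemma J_entry b c : J b c = \sum_(s < r) \sum_(a < m) k s b a * k s a c.
Proof. by rewrite summxE; apply: eq_bigr => s _; rewrite mxE. Qed.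

Lemma J_tr : J^T = J.
Proof. by rewrite linear_sum; apply: eq_bigr => s _; exact: (tr_mul_skew ksk). Qed.

(** The sum over z contributes [- J / 4]. In the sum over v, of the three terms
    of [vv_block_entry] the middle one vanishes, as the diagonals of the [k s]
    do, and the others give [J / 4] and [J / 2]. *)
Lemma alg_ric_vv b c : alg_ric j (vdir b) (vdir c) = 2^-1 * J b c.
Proof.
rewrite alg_ric_entry.
have -> : \sum_(s < r) alg_curv j (zdir s) (vdir b) (rshift m s) (lshift r c) =
    - 4^-1 * J b c.
  rewrite J_entry mulr_sumr; apply: eq_bigr => s _.
  rewrite alg_curvC mxE alg_curv_vz block_mxEdl !mxE mulNr opprK.
  rewrite mulNr -mulrN -sumrN; congr (_ * _); apply: eq_bigr => a _.
  by rewrite half_ad_vdir (skewE ksk s b a) mulNr.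
have -> : \sum_(a < m) alg_curv j (vdir a) (vdir b) (lshift r a) (lshift r c) =
    (4^-1 + 2^-1) * J b c.
  have Jbc : J b c = J c b by rewrite -[in LHS]J_tr mxE.
  rewrite mulrDl {1}Jbc !J_entry ![\sum_(s < r) \sum_(a < m) _]exchange_big /=.
  rewrite !mulr_sumr -big_split; apply: eq_bigr => a _.
  rewrite alg_curv_vv block_mxEul vv_block_entry /pairing /kfam /=.
  rewrite [X in _ * (_ - X) + _]big1 ?subr0; last first.
    by move=> s _; rewrite (skew_diag ksk s a) mul0r.
  by congr (_ * _ + _); apply: eq_bigr => s _; rewrite mulrC.
by field.
Qed.

Lemma alg_ric_zz s t : alg_ric j (zdir s) (zdir t) = - 4^-1 * \tr (k s *m k t).
Proof.
rewrite alg_ric_entry [X in _ + X]big1 ?addr0; last first.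
  by move=> u _; rewrite alg_curv_zz block_mxEdr mxE.
rewrite /mxtrace mulr_sumr; apply: eq_bigr => a _.
rewrite alg_curv_vz block_mxEur !mxE; congr (_ * _); apply: eq_bigr => b _.
by rewrite [(_)^T _ _]mxE half_ad_vdir.
Qed.

Lemma alg_ric_vz b t : alg_ric j (vdir b) (zdir t) = 0.
Proof.
rewrite alg_ric_entry !big1 ?addr0 // => [s|a] _.
  by rewrite alg_curvC mxE alg_curv_vz block_mxEdr mxE oppr0.
by rewrite alg_curv_vv block_mxEur mxE.
Qed.

Lemma alg_ric_zv s c : alg_ric j (zdir s) (vdir c) = 0.
Proof.
rewrite alg_ric_entry !big1 ?addr0 // => [t|a] _.
  by rewrite alg_curv_zz block_mxEdl mxE.
by rewrite alg_curv_vz block_mxEul mxE.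
Qed.

Lemma scal_std :
  \sum_(x < m + r) alg_ric j (delta_mx x 0) (delta_mx x 0) = 1 / 4 * \tr J.
Proof.
rewrite big_split_ord /=.
under eq_bigr do rewrite alg_ric_vv.
under [X in _ + X]eq_bigr do rewrite alg_ric_zz.
rewrite -!mulr_sumr -/(\tr J).
have -> : \sum_(s < r) \tr (k s *m k s) = \tr J by rewrite linear_sum.
by field.
Qed.

Lemma ric_normsq_std :
  \sum_(x < m + r) \sum_(y < m + r) alg_ric j (delta_mx x 0) (delta_mx y 0) ^+ 2 =
  1 / 4 * \tr (J *m J)
  + 1 / 16 * \sum_(s < r) \sum_(t < r) \tr (k s *m k t) ^+ 2.
Proof.
rewrite big_split_ord /=.
under eq_bigr => b _.
  rewrite big_split_ord /= [X in _ + X]big1 ?addr0; last first.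
    by move=> t _; rewrite alg_ric_vz expr0n.
  under eq_bigr do rewrite alg_ric_vv exprMn.
  rewrite -mulr_sumr.
  over.
under [X in _ + X]eq_bigr => s _.
  rewrite big_split_ord /= [X in X + _]big1 ?add0r; last first.
    by move=> t _; rewrite alg_ric_zv expr0n.
  under eq_bigr do rewrite alg_ric_zz exprMn sqrrN.
  rewrite -mulr_sumr.
  over.
rewrite -!mulr_sumr -/(normsq J) normsqE J_tr.
by field.
Qed.
End Components.

(** * Invariants of j and the curvature norms *)

Section BasisIndependence.
Variables (R : realType) (m r : nat) (j : {linear 'cV[R]_r -> 'M[R]_m}).
Variable Z : 'I_r -> 'cV[R]_r.

Lemma tr_sqr_Jop : \tr (Jop j Z *m Jop j Z) = I_aabb j Z.
Proof.
rewrite /Jop mulmx_suml linear_sum; apply: eq_bigr => a _.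
by rewrite mulmx_sumr linear_sum.
Qed.

Lemma tr_Jop : \tr (Jop j Z) = I_aa j Z.
Proof. exact: linear_sum. Qed.

Lemma sqr_tr_Jop : \tr (Jop j Z) ^+ 2 = I_aa_bb j Z.
Proof. by rewrite tr_Jop expr2 big_distrlr. Qed.

Hypothesis Zon : orthonormal_basis (@dot R r) Z.
Let E (s : 'I_r) : 'cV[R]_r := delta_mx s 0.

Lemma Jop_onb : Jop j Z = Jop j E.
Proof.
apply: (sum_onb (b := fun x y => j x *m j y)) => // x h y z.
  by rewrite linearP mulmxZDl.
by rewrite linearP mulmxZDr.
Qed.

Lemma I_ab_ab_onb : I_ab_ab j Z = I_ab_ab j E.
Proof.
apply: (sum_sqr_onb2 (phi := fun x y => \tr (j x *m j y))) => // x h y z.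
  by rewrite linearP mulmxZDl linearP.
by rewrite linearP mulmxZDr linearP.
Qed.

Lemma I_abab_onb : I_abab j Z = I_abab j E.
Proof.
rewrite /I_abab.
under eq_bigr => a _.
  rewrite (sum_onb (V := R^o) (b := fun x y => \tr (j (Z a) *m j x *m j (Z a) *m j y))) //.
  - over.
  - by move=> x h y z; rewrite linearP mulmxZDr !mulmxZDl linearP.
  - by move=> x h y z; rewrite linearP mulmxZDr linearP.
rewrite exchange_big [RHS]exchange_big; apply: eq_bigr => b _.
apply: (sum_onb (V := R^o) (b := fun x y => \tr (j x *m j (E b) *m j y *m j (E b)))) => //.
  by move=> x h y z; rewrite linearP !mulmxZDl linearP.
by move=> x h y z; rewrite linearP mulmxZDr !mulmxZDl linearP.
Qed.

End BasisIndependence.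

Unset Implicit Arguments.
Set Strict Implicit.
Set Printing Implicit Defensive.

Theorem lemma6 (R : realType) (m r : nat)
    (j : {linear 'cV[R]_r -> 'M[R]_m})
    (jso : forall z : 'cV[R]_r, (j z)^T = - j z)
    (Z : 'I_r -> 'cV[R]_r)
    (Zon : orthonormal_basis (@dot R r) Z)
    (p : 'cV[R]_(m + r))
    (e : 'I_(m + r) -> 'cV[R]_(m + r))
    (eon : orthonormal_basis (inner (left_metric j) p) e) :
  [/\ scal (left_metric j) p = 1 / 4%:R * \tr (Jop j Z)
      /\ 1 / 4%:R * \tr (Jop j Z) = 1 / 4%:R * I_aa j Z,
      scal (left_metric j) p ^+ 2 = 1 / 16%:R * \tr (Jop j Z) ^+ 2
      /\ 1 / 16%:R * \tr (Jop j Z) ^+ 2 = 1 / 16%:R * I_aa_bb j Z,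
      ric_normsq (left_metric j) p e
        = 1 / 4%:R * \tr (Jop j Z *m Jop j Z) + 1 / 16%:R * I_ab_ab j Z
      /\ 1 / 4%:R * \tr (Jop j Z *m Jop j Z) + 1 / 16%:R * I_ab_ab j Z
        = 1 / 4%:R * I_aabb j Z + 1 / 16%:R * I_ab_ab j Z &
      riem_normsq (left_metric j) p e
        = 1 / 2%:R * \tr (Jop j Z *m Jop j Z) + 3%:R / 8%:R * I_ab_ab j Z
          + 1 / 8%:R * I_abab j Z
      /\ 1 / 2%:R * \tr (Jop j Z *m Jop j Z) + 3%:R / 8%:R * I_ab_ab j Z
          + 1 / 8%:R * I_abab j Z
        = 1 / 2%:R * I_aabb j Z + 3%:R / 8%:R * I_ab_ab j Z
          + 1 / 8%:R * I_abab j Z].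
Proof.
have scalJ : scal (left_metric j) p = 1 / 4 * \tr (Jop j Z).
  by rewrite (scalE jso) (scal_std jso) (Jop_onb j Zon).
split; split; rewrite ?sqr_tr_Jop ?tr_sqr_Jop ?tr_Jop //.
- by rewrite scalJ tr_Jop.
- by rewrite scalJ -sqr_tr_Jop exprMn expr_div_n expr1n -natrX.
- rewrite (ric_normsqE jso eon) (ric_normsq_std jso) (I_ab_ab_onb j Zon).
  by rewrite -tr_sqr_Jop (Jop_onb j Zon).
rewrite (riem_normsqE jso eon) (riem_normsq_std jso) (I_ab_ab_onb j Zon).
by rewrite (I_abab_onb j Zon) -tr_sqr_Jop (Jop_onb j Zon) tr_sqr_Jop.
Qed.
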